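(* Let $W:I\times\mathbb{R}^n\rightrightarrows\mathbb{R}^p$ be a set-valued map such that: (1) $W_\uparrow$ is outer semicontinuous on $I\times\mathbb{R}^n$; (2) for all $(t,x)\in(0,T)\times\mathbb{R}^n$, $y\in W(t,x)$, $w^*\in\mathbb{R}^p$ with $D^*W_\uparrow(t,x,y)(w^* )\neq\emptyset$, and all $(\xi^*,v^* )\in D^*W_\uparrow(t,x,y)(w^* )$: $\xi^*+\min_{(f,L)\in(\mathrm{FL})(x)}\big(\langle v^*,f\rangle+\langle w^*,L\rangle\big)=0$; (3) for all $x\in\mathbb{R}^n$: $W_\uparrow(0,x)\subset\limsup_{t\to0^+,x'\to x}W_\uparrow(t,x')$ and $W_\uparrow(T,x)\subset\limsup_{t\to T^-,x'\to x}W_\uparrow(t,x')$; (4) for all $x\in\mathbb{R}^n$, $W(T,x)=\{0\}$. Then for all $(t,x)\in I\times\mathbb{R}^n$: $V(t,x)\subset W_\uparrow(t,x)$ and $W(t,x)\subset V_\uparrow(t,x)$.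
   Context: Setting (MOC). Fix $T>0$, $I=[0,T]$, integers $n,m,p\ge 1$, and a nonempty compact $U\subset\mathbb{R}^m$. Let $f:\mathbb{R}^n\times U\to\mathbb{R}^n$ be continuous with constants $K_f,M_f>0$ such that $\|f(x_1,u)-f(x_2,u)\|\le K_f\|x_1-x_2\|$ and $\|f(x,u)\|\le M_f$ for all $x,x_1,x_2,u$. Let $L:\mathbb{R}^n\times U\to\mathbb{R}^p$ be continuous with $\|L(x,u)\|\le M_L$ and $\|L(x_1,u)-L(x_2,u)\|\le K_L\|x_1-x_2\|$. Controls $\mathcal{U}$: bounded Lebesgue measurable $u:I\to U$. $x(s;t,x,u)$ is the solution on $[t,T]$ of $\dot x=f(x,u(s))$, $x(t)=x$; $J(t,t',x,u)=\int_t^{t'}L(x(s;t,x,u),u(s))ds$; $Y(t,x)=\{J(t,T,x,u):u\in\mathcal{U}\}$. Euclidean norms/inner products throughout. $P\subset\mathbb{R}^p$ is a closed convex pointed cone containing $0$ with nonempty interior; $\mathcal{E}(S,P)=\{y\in S:(y-P)\cap S=\{y\}\}$. $V(t,x)=\mathcal{E}(\mathrm{cl}\,Y(t,x),P)$; for any set-valued $W$, $W_\uparrow(t,x)=W(t,x)+P$ (so $V_\uparrow=V+P$). $(\mathrm{FL})(x)=\mathrm{cl}\,\mathrm{co}\{(f(x,u),L(x,u)):u\in U\}$. Proximal normal cone of $S$ at $z\in S$: $N_S(z)=\{v:\exists M>0,\langle v,\bar z-z\rangle\le M\|\bar z-z\|^2\ \forall\bar z\in S\}$. Coderivative of $F$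 at $(z,y)\in\mathrm{gph}F$: $D^*F(z,y)(w^* )=\{v^*:(v^*,-w^* )\in N_{\mathrm{gph}F}(z,y)\}$; here $z=(t,x)\in\mathbb{R}^{1+n}$ and $v^*=(\xi^*,v^* )$ split accordingly. $\limsup_{z'\to z}F(z')=\{y:\exists z_k\to z,\exists y_k\to y,\ y_k\in F(z_k)\}$ (with the indicated one-sided restriction on $t$). $F$ is outer semicontinuous at $z$ if $\limsup_{z'\to z}F(z')\subset F(z)$. *)

(* Defs.v *)
From Stdlib Require Import Reals Lra List.
From Stdlib Require Fin.
Open Scope R_scope.

Definition Vec (n : nat) := Fin.t n -> R.

Fixpoint fsum (n : nat) : (Fin.t n -> R) -> R :=
  match n return (Fin.t n -> R) -> R with
  | O => fun _ => 0
  | S k => fun g => g Fin.F1 + fsum k (fun i => g (Fin.FS i))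
  end.

Definition vzero {n} : Vec n := fun _ => 0.
Definition vadd {n} (x y : Vec n) : Vec n := fun i => x i + y i.
Definition vopp {n} (x : Vec n) : Vec n := fun i => - x i.
Definition vsub {n} (x y : Vec n) : Vec n := fun i => x i - y i.
Definition vscal {n} (a : R) (x : Vec n) : Vec n := fun i => a * x i.
Definition inner {n} (x y : Vec n) : R := fsum n (fun i => x i * y i).
Definition norm {n} (x : Vec n) : R := sqrt (inner x x).

Definition vcv {n} (y : nat -> Vec n) (l : Vec n) : Prop :=
  Un_cv (fun k => norm (vsub (y k) l)) 0.

Definition vclosed_set {n} (S : Vec n -> Prop) : Prop :=
  forall (y : nat -> Vec n) (l : Vec n), (forall k, S (y k)) -> vcv y l -> S l.

Definition vopen_set {n} (O : Vec n -> Prop) : Prop :=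
  forall v, O v -> exists r, 0 < r /\ forall w, norm (vsub w v) < r -> O w.

Definition vclosure {n} (S : Vec n -> Prop) : Vec n -> Prop :=
  fun y => forall eps, 0 < eps -> exists z, S z /\ norm (vsub z y) < eps.

Definition vcompact_set {n} (K : Vec n -> Prop) : Prop :=
  forall y : nat -> Vec n, (forall k, K (y k)) ->
    exists (phi : nat -> nat) (l : Vec n),
      (forall k, (phi k < phi (S k))%nat) /\ K l /\ vcv (fun k => y (phi k)) l.

Definition is_cone {p} (P : Vec p -> Prop) : Prop :=
  forall y a, P y -> 0 <= a -> P (vscal a y).
Definition vconvex_set {p} (P : Vec p -> Prop) : Prop :=
  forall y z a, P y -> P z -> 0 <= a <= 1 -> P (vadd (vscal a y) (vscal (1 - a) z)).
Definition pointed {p} (P : Vec p -> Prop) : Prop :=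
  forall y, P y -> P (vopp y) -> y = vzero.
Definition nonempty_interior {p} (P : Vec p -> Prop) : Prop :=
  exists y r, 0 < r /\ forall z, norm (vsub z y) < r -> P z.

Definition efficient {p} (S P : Vec p -> Prop) : Vec p -> Prop :=
  fun y => S y /\
    forall z, ((exists q, P q /\ z = vsub y q) /\ S z) <-> z = y.

Definition upset {n p} (W : R -> Vec n -> Vec p -> Prop) (P : Vec p -> Prop)
  : R -> Vec n -> Vec p -> Prop :=
  fun t x y => exists w q, W t x w /\ P q /\ y = vadd w q.

Definition cover_le (E : R -> Prop) (r : R) : Prop :=
  exists a b : nat -> R, (forall k, a k <= b k) /\
    (forall s, E s -> exists k, a k < s < b k) /\
    (forall N, sum_f_R0 (fun k => b k - a k) N <= r).

Definition null_set (E : R -> Prop) : Prop := forall eps, 0 < eps -> cover_le E eps.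

Definition open_R (G : R -> Prop) : Prop :=
  forall s, G s -> exists d, 0 < d /\ forall r, Rabs (r - s) < d -> G r.

Definition leb_measurable (E : R -> Prop) : Prop :=
  forall eps, 0 < eps -> exists G, open_R G /\ (forall s, E s -> G s) /\
    cover_le (fun s => G s /\ ~ E s) eps.

Definition measurable_on {m} (a b : R) (u : R -> Vec m) : Prop :=
  forall O : Vec m -> Prop, vopen_set O ->
    leb_measurable (fun s => a <= s <= b /\ O (u s)).

Definition ae_on (a b : R) (Pr : R -> Prop) : Prop :=
  null_set (fun s => a <= s <= b /\ ~ Pr s).

Fixpoint nonoverlapping (l : list (R * R)) : Prop :=
  match l with
  | nil => True
  | (a, b) :: l' => a <= b /\ Forall (fun cd => b <= fst cd) l' /\ nonoverlapping l'
  end.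

Definition abs_cont_on {n} (a b : R) (g : R -> Vec n) : Prop :=
  forall eps, 0 < eps -> exists d, 0 < d /\
    forall l : list (R * R), nonoverlapping l ->
      Forall (fun cd => a <= fst cd /\ snd cd <= b) l ->
      fold_right (fun cd acc => (snd cd - fst cd) + acc) 0 l < d ->
      fold_right (fun cd acc => norm (vsub (g (snd cd)) (g (fst cd))) + acc) 0 l < eps.

Definition has_vderiv {n} (g : R -> Vec n) (s : R) (d : Vec n) : Prop :=
  forall i, derivable_pt_lim (fun r => g r i) s (d i).

Definition admissible {m} (T : R) (U : Vec m -> Prop) (u : R -> Vec m) : Prop :=
  (forall s, 0 <= s <= T -> U (u s)) /\
  (exists M, forall s, 0 <= s <= T -> norm (u s) <= M) /\
  measurable_on 0 T u.

Definition is_solution {n m} (T : R) (f : Vec n -> Vec m -> Vec n)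
  (t : R) (x0 : Vec n) (u : R -> Vec m) (xi : R -> Vec n) : Prop :=
  xi t = x0 /\ abs_cont_on t T xi /\
  ae_on t T (fun s => has_vderiv xi s (f (xi s) (u s))).

(** Lebesgue integral  c(T) = ∫_t^T g(s) ds, with c the absolutely continuous
    primitive of the bounded measurable g, c(t) = 0 *)
Definition is_integral {p} (t T : R) (g : R -> Vec p) (y : Vec p) : Prop :=
  exists c : R -> Vec p, c t = vzero /\ abs_cont_on t T c /\
    ae_on t T (fun s => has_vderiv c s (g s)) /\ y = c T.

Definition Yset {n m p} (T : R) (U : Vec m -> Prop) (f : Vec n -> Vec m -> Vec n)
  (L : Vec n -> Vec m -> Vec p) (t : R) (x : Vec n) : Vec p -> Prop :=
  fun y => exists (u : R -> Vec m) (xi : R -> Vec n),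
    admissible T U u /\ is_solution T f t x u xi /\
    is_integral t T (fun s => L (xi s) (u s)) y.

Definition Vset {n m p} (T : R) (U : Vec m -> Prop) (f : Vec n -> Vec m -> Vec n)
  (L : Vec n -> Vec m -> Vec p) (P : Vec p -> Prop) : R -> Vec n -> Vec p -> Prop :=
  fun t x => efficient (vclosure (Yset T U f L t x)) P.

Definition co_FL {n m p} (U : Vec m -> Prop) (f : Vec n -> Vec m -> Vec n)
  (L : Vec n -> Vec m -> Vec p) (x : Vec n) (a : Vec n) (b : Vec p) : Prop :=
  exists l : list (R * Vec m),
    Forall (fun lu => 0 <= fst lu /\ U (snd lu)) l /\
    fold_right (fun lu acc => fst lu + acc) 0 l = 1 /\
    a = fold_right (fun lu acc => vadd (vscal (fst lu) (f x (snd lu))) acc) vzero l /\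
    b = fold_right (fun lu acc => vadd (vscal (fst lu) (L x (snd lu))) acc) vzero l.

Definition FL {n m p} (U : Vec m -> Prop) (f : Vec n -> Vec m -> Vec n)
  (L : Vec n -> Vec m -> Vec p) (x : Vec n) (a : Vec n) (b : Vec p) : Prop :=
  forall eps, 0 < eps -> exists a' b', co_FL U f L x a' b' /\
    norm (vsub a' a) < eps /\ norm (vsub b' b) < eps.

Definition graph {n p} (T : R) (F : R -> Vec n -> Vec p -> Prop)
  (t : R) (x : Vec n) (y : Vec p) : Prop := 0 <= t <= T /\ F t x y.

Definition prox_normal {n p} (T : R) (F : R -> Vec n -> Vec p -> Prop)
  (t : R) (x : Vec n) (y : Vec p) (xi : R) (v : Vec n) (w : Vec p) : Prop :=
  graph T F t x y /\
  exists M, 0 < M /\ forall t' x' y', graph T F t' x' y' ->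
    xi * (t' - t) + inner v (vsub x' x) + inner w (vsub y' y)
      <= M * ((t' - t) ^ 2 + inner (vsub x' x) (vsub x' x) + inner (vsub y' y) (vsub y' y)).

Definition coderiv {n p} (T : R) (F : R -> Vec n -> Vec p -> Prop)
  (t : R) (x : Vec n) (y : Vec p) (ws : Vec p) (xis : R) (vs : Vec n) : Prop :=
  prox_normal T F t x y xis vs (vopp ws).

Definition osc_on {n p} (T : R) (F : R -> Vec n -> Vec p -> Prop) : Prop :=
  forall t x, 0 <= t <= T ->
    forall y, (exists (tk : nat -> R) (xk : nat -> Vec n) (yk : nat -> Vec p),
                 (forall k, 0 <= tk k <= T /\ F (tk k) (xk k) (yk k)) /\
                 Un_cv tk t /\ vcv xk x /\ vcv yk y) ->
              F t x y.

Definition limsup_within {n p} (D : R -> Prop) (F : R -> Vec n -> Vec p -> Prop)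
  (t0 : R) (x : Vec n) (y : Vec p) : Prop :=
  exists (tk : nat -> R) (xk : nat -> Vec n) (yk : nat -> Vec p),
    (forall k, D (tk k) /\ F (tk k) (xk k) (yk k)) /\
    Un_cv tk t0 /\ vcv xk x /\ vcv yk y.

(* Main.v *)
(** By (2) every proximal normal of the closed graph of the upper set of [W] makes a
    nonnegative product with all the velocities [(1, f, - L)], and a nonpositive one with at
    least one of them.  The first fact makes the graph invariant backward in time along every
    trajectory: starting from [(T, x(T), 0)], the squared distance to the graph satisfies a
    Gronwall inequality, so all attainable costs lie in the upset of [W].  The second fact
    makes it approximately viable forward: choosing a piecewise constant control against the
    normal at the closest point (proximal aiming) keeps the trajectory close to the graph up
    to time [T], where the graph is [P], so every point of [W(t, x)] dominates a limit of
    attainable costs, and hence an efficient one.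

    Normals with base time [0] or [T] are out of reach of (2).  They are avoided by starting
    at the interior points provided by (3) and by giving the time coordinate a large weight
    [l] in the distance; the growth rate does not depend on [l] as the system is autonomous. *)
From Coquelicot Require Import Coquelicot.
Require Import Defs.
From Stdlib Require Import Reals List Lra Lia Psatz.
From Stdlib Require Import Classical FunctionalExtensionality IndefiniteDescription.
Open Scope R_scope.

(** * Euclidean vectors *)

(** The distance to the graph is never differentiated. At each time the closest point is frozen and
    the explicit squared distance to that fixed point is expanded; it majorizes the squared distance
    to the graph at the neighbouring times. Condition (2) speaks of velocities at the closest point
    and not on the trajectory; the discrepancy is at most a Lipschitz constant times the squared
    distance, which is what a Gronwall estimate absorbs. The third coordinate follows the cost still
    to be paid, [y - c s], whence the sign of [L]. Controls are only measurable, so trajectories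
    have derivatives almost everywhere. Instead of an integration theory, null sets enter through
    monotone functions that grow with slope one around the exceptional times, and inequalities are
    propagated by induction along an interval. In the forward direction each step needs one value of
    the control, so no measurable selection occurs, and Picard iteration on short steps builds the
    trajectory. *)

Ltac vec_ext := apply functional_extensionality; intro;
  unfold vadd, vsub, vscal, vopp, vzero; try ring; try lra.

Lemma fsum_ext n (g h : Fin.t n -> R) : (forall i, g i = h i) -> fsum n g = fsum n h.
Proof. intros H; f_equal; apply functional_extensionality; exact H. Qed.

Lemma fsum_linear n (g h : Fin.t n -> R) a b :
  fsum n (fun i => a * g i + b * h i) = a * fsum n g + b * fsum n h.
Proof.
  induction n as [|n IH]; simpl; [ring|].
  rewrite (IH (fun i => g (Fin.FS i)) (fun i => h (Fin.FS i))); ring.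
Qed.

Lemma fsum_le n (g h : Fin.t n -> R) : (forall i, g i <= h i) -> fsum n g <= fsum n h.
Proof.
  induction n as [|n IH]; simpl; intros H; [lra|].
  apply Rplus_le_compat; [apply H|apply IH; intros; apply H].
Qed.

Lemma fsum_const n c : fsum n (fun _ => c) = INR n * c.
Proof.
  induction n as [|n IH]; [simpl; ring|].
  change (c + fsum n (fun _ => c) = INR (S n) * c); rewrite IH, S_INR; ring.
Qed.

Lemma fsum_nonneg n (g : Fin.t n -> R) : (forall i, 0 <= g i) -> 0 <= fsum n g.
Proof.
  intros H; apply Rle_trans with (fsum n (fun _ => 0)).
  - rewrite fsum_const; lra.
  - now apply fsum_le.
Qed.

Lemma fsum_ge_term n (g : Fin.t n -> R) i : (forall i, 0 <= g i) -> g i <= fsum n g.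
Proof.
  induction i as [n|n i IH]; simpl; intros H.
  - pose proof (fsum_nonneg n (fun i => g (Fin.FS i)) (fun i => H _)); lra.
  - pose proof (IH (fun i => g (Fin.FS i)) (fun i => H _)); pose proof (H Fin.F1); simpl in *; lra.
Qed.

Lemma inner_sym n (x y : Vec n) : inner x y = inner y x.
Proof. apply fsum_ext; intros; ring. Qed.

Lemma inner_linear n a b (x y z : Vec n) :
  inner (vadd (vscal a x) (vscal b y)) z = a * inner x z + b * inner y z.
Proof.
  unfold inner; rewrite <- fsum_linear; apply fsum_ext; intros; unfold vadd, vscal; ring.
Qed.

Lemma inner_add_l n (x y z : Vec n) : inner (vadd x y) z = inner x z + inner y z.
Proof.
  replace (vadd x y) with (vadd (vscal 1 x) (vscal 1 y)) by vec_ext.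
  rewrite inner_linear; ring.
Qed.

Lemma inner_sub_l n (x y z : Vec n) : inner (vsub x y) z = inner x z - inner y z.
Proof.
  replace (vsub x y) with (vadd (vscal 1 x) (vscal (-1) y)) by vec_ext.
  rewrite inner_linear; ring.
Qed.

Lemma inner_scal_l n a (x z : Vec n) : inner (vscal a x) z = a * inner x z.
Proof.
  replace (vscal a x) with (vadd (vscal a x) (vscal 0 x)) by vec_ext.
  rewrite inner_linear; ring.
Qed.

Lemma inner_opp_l n (x z : Vec n) : inner (vopp x) z = - inner x z.
Proof.
  replace (vopp x) with (vscal (-1) x) by vec_ext.
  rewrite inner_scal_l; ring.
Qed.

Lemma inner_zero_l n (z : Vec n) : inner vzero z = 0.
Proof.
  replace (@vzero n) with (vscal 0 z) by vec_ext.
  rewrite inner_scal_l; ring.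
Qed.

Lemma inner_add_r n (x y z : Vec n) : inner z (vadd x y) = inner z x + inner z y.
Proof. now rewrite !(inner_sym _ z), inner_add_l. Qed.

Lemma inner_sub_r n (x y z : Vec n) : inner z (vsub x y) = inner z x - inner z y.
Proof. now rewrite !(inner_sym _ z), inner_sub_l. Qed.

Lemma inner_scal_r n a (x z : Vec n) : inner z (vscal a x) = a * inner z x.
Proof. now rewrite !(inner_sym _ z), inner_scal_l. Qed.

Lemma inner_opp_r n (x z : Vec n) : inner z (vopp x) = - inner z x.
Proof. now rewrite !(inner_sym _ z), inner_opp_l. Qed.

Lemma inner_zero_r n (z : Vec n) : inner z vzero = 0.
Proof. now rewrite inner_sym, inner_zero_l. Qed.

Lemma inner_nonneg n (x : Vec n) : 0 <= inner x x.
Proof. apply fsum_nonneg; intros; nra. Qed.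

Lemma norm_nonneg n (x : Vec n) : 0 <= norm x.
Proof. apply sqrt_pos. Qed.

Lemma norm_sqr n (x : Vec n) : norm x * norm x = inner x x.
Proof. apply sqrt_sqrt, inner_nonneg. Qed.

Lemma cauchy_schwarz_sqr n (x y : Vec n) :
  inner x y * inner x y <= inner x x * inner y y.
Proof.
  assert (H : forall t, 0 <= inner x x + 2 * t * inner x y + t * t * inner y y).
  { intros t; pose proof (inner_nonneg _ (vadd x (vscal t y))) as H.
    rewrite inner_add_l, !inner_add_r, !inner_scal_l, !inner_scal_r, (inner_sym _ y x) in H; lra. }
  pose proof (inner_nonneg _ x); pose proof (inner_nonneg _ y) as Hy.
  destruct (Rle_lt_or_eq_dec _ _ Hy) as [Hp|Hz].
  - specialize (H (- inner x y / inner y y)).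
    assert (E : inner x x + 2 * (- inner x y / inner y y) * inner x y
       + - inner x y / inner y y * (- inner x y / inner y y) * inner y y
       = (inner x x * inner y y - inner x y * inner x y) / inner y y) by (field; lra).
    rewrite E in H.
    destruct (Rle_lt_dec (inner x y * inner x y) (inner x x * inner y y)) as [|C]; [assumption|].
    assert ((inner x x * inner y y - inner x y * inner x y) / inner y y < 0); [|lra].
    apply Rmult_lt_reg_r with (inner y y); [assumption|]; field_simplify; nra.
  - destruct (Req_dec (inner x y) 0) as [E|E]; [rewrite E; nra|].
    specialize (H (- (inner x x + 1) / (2 * inner x y))); rewrite <- Hz in H.
    replace (inner x x + 2 * (- (inner x x + 1) / (2 * inner x y)) * inner x y +
      - (inner x x + 1) / (2 * inner x y) * (- (inner x x + 1) / (2 * inner x y)) * 0)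
      with (-1) in H by (field; assumption).
    lra.
Qed.

Lemma cauchy_schwarz n (x y : Vec n) : Rabs (inner x y) <= norm x * norm y.
Proof.
  pose proof (cauchy_schwarz_sqr _ x y); pose proof (norm_nonneg _ x); pose proof (norm_nonneg _ y).
  rewrite <- !norm_sqr in H.
  rewrite <- (Rabs_pos_eq (norm x * norm y)) by nra.
  apply Rsqr_le_abs_0; unfold Rsqr; nra.
Qed.

Lemma norm_le_sqr n (x : Vec n) r : 0 <= r -> inner x x <= r * r -> norm x <= r.
Proof. intros Hr H; rewrite <- norm_sqr in H; pose proof (norm_nonneg _ x); nra. Qed.

Lemma norm_add n (x y : Vec n) : norm (vadd x y) <= norm x + norm y.
Proof.
  pose proof (norm_nonneg _ x); pose proof (norm_nonneg _ y).
  apply norm_le_sqr; [lra|].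
  rewrite inner_add_l, !inner_add_r, (inner_sym _ y x).
  pose proof (cauchy_schwarz _ x y); pose proof (Rle_abs (inner x y)).
  rewrite <- !norm_sqr; nra.
Qed.

Lemma norm_scal n a (x : Vec n) : norm (vscal a x) = Rabs a * norm x.
Proof.
  unfold norm; rewrite inner_scal_l, inner_scal_r, <- Rmult_assoc, sqrt_mult_alt by nra.
  f_equal; apply sqrt_Rsqr_abs.
Qed.

Lemma norm_opp n (x : Vec n) : norm (vopp x) = norm x.
Proof. unfold norm; now rewrite inner_opp_l, inner_opp_r, Ropp_involutive. Qed.

Lemma norm_sub_sym n (x y : Vec n) : norm (vsub x y) = norm (vsub y x).
Proof. rewrite <- norm_opp; f_equal; vec_ext. Qed.

Lemma norm_sub_triang n (y x z : Vec n) : norm (vsub x z) <= norm (vsub x y) + norm (vsub y z).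
Proof.
  replace (vsub x z) with (vadd (vsub x y) (vsub y z)) by vec_ext; apply norm_add.
Qed.

Lemma norm_zero n : norm (@vzero n) = 0.
Proof. unfold norm; rewrite inner_zero_l; apply sqrt_0. Qed.

Lemma norm_sub_self n (x : Vec n) : norm (vsub x x) = 0.
Proof. replace (vsub x x) with (@vzero n) by vec_ext; apply norm_zero. Qed.

Lemma norm_le_sub n (x y : Vec n) : norm x <= norm y + norm (vsub x y).
Proof. replace x with (vadd y (vsub x y)) at 1 by vec_ext; apply norm_add. Qed.

Lemma norm_coord n (x : Vec n) i : Rabs (x i) <= norm x.
Proof.
  pose proof (norm_nonneg _ x) as H.
  assert (E : x i * x i <= norm x * norm x).
  { rewrite norm_sqr; apply (fsum_ge_term _ (fun i => x i * x i)); intros; nra. }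
  apply Rabs_le; split; nra.
Qed.

Lemma norm_le_coord n (x : Vec n) r : (forall i, Rabs (x i) <= r) -> norm x <= INR n * r.
Proof.
  intros H; destruct n as [|n].
  - unfold norm, inner; simpl; rewrite sqrt_0; lra.
  - assert (0 <= r) by (eapply Rle_trans; [apply Rabs_pos|apply (H Fin.F1)]).
    assert (1 <= INR (S n)) by (rewrite S_INR; pose proof (pos_INR n); lra).
    apply norm_le_sqr; [nra|].
    apply Rle_trans with (fsum (S n) (fun _ => r * r)).
    + apply fsum_le; intros i; specialize (H i); apply Rabs_le_between in H; nra.
    + rewrite fsum_const; nra.
Qed.

Lemma norm_eq_zero n (x : Vec n) : norm x = 0 -> x = vzero.
Proof.
  intros H; apply functional_extensionality; intros i; pose proof (norm_coord _ x i) as Hi.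
  rewrite H in Hi; pose proof (Rabs_pos (x i)); unfold vzero.
  destruct (Req_dec (x i) 0) as [|N]; [assumption|apply Rabs_no_R0 in N; lra].
Qed.

Lemma norm_sub_eq n (x y : Vec n) : norm (vsub x y) <= 0 -> x = y.
Proof.
  intros H; pose proof (norm_nonneg _ (vsub x y)).
  assert (E : vsub x y = vzero) by (apply norm_eq_zero; lra).
  apply functional_extensionality; intros i.
  apply (f_equal (fun g => g i)) in E; unfold vsub, vzero in E; lra.
Qed.

(** * Sequences *)

Lemma vcv_iff n (y : nat -> Vec n) l :
  vcv y l <-> forall eps, 0 < eps -> exists N, forall k, (N <= k)%nat -> norm (vsub (y k) l) < eps.
Proof.
  split; intros H eps He; destruct (H eps He) as [N HN]; exists N; intros k Hk.
  - specialize (HN k Hk); unfold Rdist in HN.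
    rewrite Rminus_0_r, Rabs_pos_eq in HN by apply norm_nonneg; exact HN.
  - unfold Rdist; rewrite Rminus_0_r, Rabs_pos_eq by apply norm_nonneg; now apply HN.
Qed.

Lemma vcv_const n (l : Vec n) : vcv (fun _ => l) l.
Proof. apply vcv_iff; intros e He; exists O; intros; now rewrite norm_sub_self. Qed.

Lemma vcv_dominated n (y : nat -> Vec n) l (r : nat -> R) :
  (forall k, norm (vsub (y k) l) <= r k) -> Un_cv r 0 -> vcv y l.
Proof.
  intros H Hr; apply vcv_iff; intros e He; destruct (Hr e He) as [N HN]; exists N; intros k Hk.
  specialize (HN k Hk); unfold Rdist in HN; rewrite Rminus_0_r in HN.
  eapply Rle_lt_trans; [apply H|]; eapply Rle_lt_trans; [apply Rle_abs|exact HN].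
Qed.

Definition increasing_nat (phi : nat -> nat) := forall k, (phi k < phi (S k))%nat.

Lemma increasing_nat_ge phi : increasing_nat phi -> forall k, (k <= phi k)%nat.
Proof. intros H k; induction k as [|k IH]; [lia|specialize (H k); lia]. Qed.

Lemma increasing_nat_lt phi : increasing_nat phi -> forall j k, (j < k)%nat -> (phi j < phi k)%nat.
Proof. intros H j k Hjk; induction Hjk as [|k Hk IH]; [apply H|specialize (H k); lia]. Qed.

Lemma increasing_nat_comp phi psi :
  increasing_nat phi -> increasing_nat psi -> increasing_nat (fun k => phi (psi k)).
Proof. intros H1 H2 k; apply increasing_nat_lt; [assumption|apply H2]. Qed.

Lemma Un_cv_subseq y l phi : increasing_nat phi -> Un_cv y l -> Un_cv (fun k => y (phi k)) l.
Proof.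
  intros Hp H e He; destruct (H e He) as [N HN]; exists N; intros k Hk; apply HN.
  pose proof (increasing_nat_ge phi Hp k); lia.
Qed.

Lemma vcv_subseq n (y : nat -> Vec n) l phi :
  increasing_nat phi -> vcv y l -> vcv (fun k => y (phi k)) l.
Proof. intros Hp H; exact (Un_cv_subseq _ _ phi Hp H). Qed.

(** Dependent choice: the choice function takes the rank together with a lower bound, and the
    recursion feeds it the successor of the previous index. *)
Lemma subseq_exists (Q : nat -> nat -> Prop) :
  (forall k N, exists j, (N <= j)%nat /\ Q k j) ->
  exists phi, increasing_nat phi /\ forall k, Q k (phi k).
Proof.
  intros H.
  assert (C : forall kN : nat * nat, exists j, (snd kN <= j)%nat /\ Q (fst kN) j)
    by (intros [k N]; apply H).
  apply functional_choice in C; destruct C as [g Hg].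
  exists (nat_rect (fun _ => nat) (g (O, O)) (fun k r => g (S k, S r))); split.
  - intros k; simpl. pose proof (proj1 (Hg (S k, S (nat_rect (fun _ => nat) (g (O, O)) (fun k r => g (S k, S r)) k)))) as Q1.
    simpl in Q1; lia.
  - intros [|k]; simpl; apply (proj2 (Hg (_, _))).
Qed.

(** The limit is the limit inferior, the supremum of the set [A] of eventual lower bounds:
    eventually all terms exceed [l - e], and beyond every rank some term is below [l + e]. *)
Lemma bolzano_weierstrass_R (y : nat -> R) M :
  (forall k, Rabs (y k) <= M) -> exists phi l, increasing_nat phi /\ Un_cv (fun k => y (phi k)) l.
Proof.
  intros HM.
  set (A := fun r => exists N, forall j, (N <= j)%nat -> r <= y j).
  assert (HA : exists l, is_lub A l).
  { destruct (completeness A) as [l Hl].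
    - exists M; intros r [N HN]; specialize (HN N (le_n N)); specialize (HM N).
      apply Rabs_le_between in HM; lra.
    - exists (- M), O; intros j _; specialize (HM j); apply Rabs_le_between in HM; lra.
    - now exists l. }
  destruct HA as [l [Hub Hlub]].
  destruct (subseq_exists (fun k j => Rabs (y j - l) < / (INR k + 1))) as [phi [Hp Hphi]].
  { intros k N; assert (Hk : 0 < / (INR k + 1)) by (apply Rinv_0_lt_compat; pose proof (pos_INR k); lra).
    set (e := / (INR k + 1)) in *.
    assert (H1 : exists N1, forall j, (N1 <= j)%nat -> l - e < y j).
    { apply NNPP; intros C.
      assert (B : is_upper_bound A (l - e)).
      { intros r [N1 HN1]; destruct (Rle_lt_dec r (l - e)) as [|Hr]; [assumption|].
        exfalso; apply C; exists N1; intros j Hj; specialize (HN1 j Hj); lra. }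
      specialize (Hlub _ B); lra. }
    destruct H1 as [N1 HN1].
    apply NNPP; intros C.
    assert (B : A (l + e)).
    { exists (max N N1); intros j Hj; destruct (Rle_lt_dec (l + e) (y j)) as [|Hr]; [assumption|].
      exfalso; apply C; exists j; split; [lia|]; specialize (HN1 j ltac:(lia)).
      apply Rabs_def1; lra. }
    specialize (Hub _ B); lra. }
  exists phi, l; split; [assumption|].
  intros e He; destruct (archimed_cor1 e He) as [N [HN HN0]]; exists N; intros k Hk; unfold Rdist.
  eapply Rlt_trans; [apply Hphi|]; eapply Rle_lt_trans; [|exact HN].
  apply Rinv_le_contravar; [apply lt_0_INR; lia|].
  apply le_INR in Hk; lra.
Qed.

Lemma vcv_of_coords n (y : nat -> Vec n) l :
  (forall i, Un_cv (fun k => y k i) (l i)) -> vcv y l.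
Proof.
  intros H.
  assert (HN : forall e, 0 < e -> exists N, forall i k, (N <= k)%nat -> Rabs (y k i - l i) < e).
  { intros e He; clear - H He; induction n as [|n IH].
    - exists O; intros i; apply (Fin.case0 (fun i => _) i).
    - destruct (H Fin.F1 e He) as [N1 H1].
      destruct (IH (fun k i => y k (Fin.FS i)) (fun i => l (Fin.FS i))) as [N2 H2].
      { intros i; apply H. }
      exists (max N1 N2); intros i; apply (Fin.caseS' i).
      + intros k Hk; apply H1; lia.
      + intros j k Hk; apply H2; lia. }
  apply vcv_iff; intros e He.
  pose proof (pos_INR n) as Hn.
  (* The summand [1] covers dimension zero and keeps the final inequality strict. *)
  assert (He' : 0 < e / (INR n + 1)) by (apply Rdiv_lt_0_compat; lra).
  destruct (HN _ He') as [N HN']; exists N; intros k Hk.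
  eapply Rle_lt_trans; [apply norm_le_coord; intros i; apply Rlt_le, (HN' i k Hk)|].
  replace (INR n * (e / (INR n + 1))) with (e - e / (INR n + 1)) by (field; lra); lra.
Qed.

Lemma bolzano_weierstrass n (y : nat -> Vec n) M :
  (forall k, norm (y k) <= M) -> exists phi l, increasing_nat phi /\ vcv (fun k => y (phi k)) l.
Proof.
  intros HM.
  assert (HM' : forall k i, Rabs (y k i) <= M)
    by (intros; eapply Rle_trans; [apply norm_coord|apply HM]).
  (* Convergence is put in coordinates so that the induction can split off the first one. *)
  enough (exists phi l, increasing_nat phi /\ forall i, Un_cv (fun k => y (phi k) i) (l i)) as
    (phi & l & Hp & Hl) by (exists phi, l; split; [assumption|now apply vcv_of_coords]).
  clear HM; induction n as [|n IH].
  - exists (fun k => k), vzero; split; [intros k; lia|]; intros i; apply (Fin.case0 (fun i => _) i).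
  - destruct (IH (fun k i => y k (Fin.FS i))) as (phi & l & Hp & Hl); [intros; apply HM'|].
    destruct (bolzano_weierstrass_R (fun k => y (phi k) Fin.F1) M) as (psi & a & Hs & Ha);
      [intros; apply HM'|].
    exists (fun k => phi (psi k)), (fun i => Fin.caseS' i (fun _ => R) a l).
    split; [now apply increasing_nat_comp|].
    intros i; apply (Fin.caseS' i); simpl; [assumption|].
    intros j; exact (Un_cv_subseq _ _ psi Hs (Hl j)).
Qed.

Lemma vcv_unique n (y : nat -> Vec n) l l' : vcv y l -> vcv y l' -> l = l'.
Proof.
  intros H H'; apply norm_sub_eq, Rnot_lt_le; intros C.
  rewrite vcv_iff in H, H'; set (e := norm (vsub l l')) in *.
  destruct (H (e / 2) ltac:(lra)) as [N HN]; destruct (H' (e / 2) ltac:(lra)) as [N' HN'].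
  specialize (HN (max N N') ltac:(lia)); specialize (HN' (max N N') ltac:(lia)).
  pose proof (norm_sub_triang _ (y (max N N')) l l') as Ht; rewrite norm_sub_sym in HN.
  unfold e in *; lra.
Qed.

Lemma vcv_sub n (y z : nat -> Vec n) l l' :
  vcv y l -> vcv z l' -> vcv (fun k => vsub (y k) (z k)) (vsub l l').
Proof.
  intros H H'; eapply vcv_dominated.
  - intros k; replace (vsub (vsub (y k) (z k)) (vsub l l')) with
      (vadd (vsub (y k) l) (vopp (vsub (z k) l'))) by vec_ext.
    eapply Rle_trans; [apply norm_add|]; rewrite norm_opp; apply Rle_refl.
  - replace 0 with (0 + 0) by ring; apply CV_plus; assumption.
Qed.

(** * Null sets and absolutely continuous functions *)

(* [m] is the cumulative length of a cover of [E] of total length at most [eta]: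
   it grows with slope at least one around every point of [E]. *)
Lemma null_set_gauge E eta : null_set E -> 0 < eta ->
  exists m : R -> R, (forall r s, r <= s -> m r <= m s) /\ (forall s, 0 <= m s <= eta) /\
    forall s, E s -> exists h, 0 < h /\
      forall r r', s - h <= r -> r <= r' -> r' <= s + h -> r' - r <= m r' - m r.
Proof.
  intros HE He; destruct (HE eta He) as (a & b & Hab & Hcov & Hsum).
  (* [tm s k] is the length of the part of the interval number [k] that lies to the left of [s]. *)
  set (tm := fun s k => Rmax 0 (Rmin s (b k) - a k)).
  assert (Hb : forall s k, 0 <= tm s k <= b k - a k).
  { intros s k; specialize (Hab k); unfold tm, Rmax, Rmin; repeat destruct Rle_dec; lra. }
  assert (Hm : forall r s k, r <= s -> tm r k <= tm s k).
  { intros r s k Hrs; specialize (Hab k); unfold tm, Rmax, Rmin; repeat destruct Rle_dec; lra. }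
  assert (Hbd : forall s N, sum_f_R0 (tm s) N <= eta).
  { intros s N; eapply Rle_trans; [|apply (Hsum N)]; apply sum_Rle; intros; apply Hb. }
  assert (Hcv : forall s, exists l, Un_cv (sum_f_R0 (tm s)) l).
  { intros s; destruct (Un_cv_crit (sum_f_R0 (tm s))) as [l Hl]; [| |now exists l].
    - intros k; simpl; pose proof (Hb s (S k)); lra.
    - exists eta; intros r [N ->]; apply Hbd. }
  apply functional_choice in Hcv; destruct Hcv as [m Hmcv].
  (* An eventual inequality between partial sums passes to the limit; [c = 0] gives monotonicity,
     [c = r' - r] the slope around covered points. *)
  assert (Hlim : forall c r s, (exists N, forall k, (N <= k)%nat ->
      sum_f_R0 (tm r) k + c <= sum_f_R0 (tm s) k) -> m r + c <= m s).
  { intros c r s [N HN]; apply Rnot_lt_le; intros C.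
    set (e := (m r + c - m s) / 2).
    destruct (Hmcv r e) as [N1 H1]; [unfold e; lra|].
    destruct (Hmcv s e) as [N2 H2]; [unfold e; lra|].
    specialize (HN (max N (max N1 N2)) ltac:(lia)).
    specialize (H1 (max N (max N1 N2)) ltac:(lia)); specialize (H2 (max N (max N1 N2)) ltac:(lia)).
    apply Rabs_def2 in H1, H2; unfold e in *; lra. }
  exists m; repeat split.
  - intros r s Hrs; replace (m r) with (m r + 0) by ring; apply Hlim; exists O; intros k _.
    rewrite Rplus_0_r; apply sum_Rle; intros; now apply Hm.
  - apply Rnot_lt_le; intros C; destruct (Hmcv s (- m s)) as [N HN]; [lra|].
    specialize (HN N (le_n N)); apply Rabs_def2 in HN.
    assert (0 <= sum_f_R0 (tm s) N) by (apply cond_pos_sum; intros; apply Hb); lra.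
  - apply Rnot_lt_le; intros C; destruct (Hmcv s (m s - eta)) as [N HN]; [lra|].
    specialize (HN N (le_n N)); apply Rabs_def2 in HN; specialize (Hbd s N); lra.
  (* Inside the interval number [k] its own term grows by [r' - r], and no other term decreases. *)
  - intros s Hs; destruct (Hcov s Hs) as [k Hk]; exists (Rmin (s - a k) (b k - s)).
    split; [apply Rmin_pos; lra|]; intros r r' H1 H2 H3.
    enough (m r + (r' - r) <= m r') by lra.
    apply Hlim; exists k; intros j Hj; induction Hj as [|j Hj IH].
    + assert (Hk' : tm r k + (r' - r) <= tm r' k).
      { pose proof (Rmin_l (s - a k) (b k - s)); pose proof (Rmin_r (s - a k) (b k - s)).
        unfold tm; rewrite !Rmin_left, !Rmax_right; lra. }
      destruct k as [|k]; simpl; [assumption|].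
      assert (sum_f_R0 (tm r) k <= sum_f_R0 (tm r') k)
        by (apply sum_Rle; intros; now apply Hm); lra.
    + simpl; pose proof (Hm r r' (S j) H2); lra.
Qed.

Lemma null_set_subset (E E' : R -> Prop) : (forall s, E s -> E' s) -> null_set E' -> null_set E.
Proof.
  intros H HE eps He; destruct (HE eps He) as (a & b & Hab & Hc & Hs).
  exists a, b; repeat split; auto.
Qed.

Definition interleave (a b : nat -> R) (k : nat) := if Nat.even k then a (Nat.div2 k) else b (Nat.div2 k).

Lemma interleave_even a b k : interleave a b (2 * k) = a k.
Proof.
  unfold interleave; rewrite Nat.even_mul; simpl orb.
  now rewrite Nat.div2_double.
Qed.

Lemma interleave_odd a b k : interleave a b (S (2 * k)) = b k.
Proof.
  unfold interleave; rewrite Nat.even_succ, Nat.odd_mul; simpl andb.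
  now rewrite Nat.div2_succ_double.
Qed.

Lemma sum_incr_le (g : nat -> R) N N' : (N <= N')%nat -> (forall k, 0 <= g k) ->
  sum_f_R0 g N <= sum_f_R0 g N'.
Proof. intros HN Hg; induction HN as [|k Hk IH]; simpl; [lra|specialize (Hg (S k)); lra]. Qed.

Lemma cover_le_union E E' r r' : cover_le E r -> cover_le E' r' ->
  cover_le (fun s => E s \/ E' s) (r + r').
Proof.
  intros (a & b & Hab & Hc & Hs) (a' & b' & Hab' & Hc' & Hs').
  assert (Hpos : forall k, 0 <= interleave b b' k - interleave a a' k).
  { intros k; unfold interleave; specialize (Hab (Nat.div2 k)); specialize (Hab' (Nat.div2 k)).
    destruct Nat.even; lra. }
  exists (interleave a a'), (interleave b b'); repeat split.
  - intros k; specialize (Hpos k); lra.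
  - intros s [H|H].
    + destruct (Hc s H) as [k Hk]; exists (2 * k)%nat; now rewrite !interleave_even.
    + destruct (Hc' s H) as [k Hk]; exists (S (2 * k)); now rewrite !interleave_odd.
  - intros N.
    assert (E0 : forall N, sum_f_R0 (fun k => interleave b b' k - interleave a a' k) (S (2 * N)) =
      sum_f_R0 (fun k => b k - a k) N + sum_f_R0 (fun k => b' k - a' k) N).
    { clear - a; induction N as [|N IH].
      - simpl; unfold interleave; simpl; ring.
      - replace (S (2 * S N)) with (S (S (S (2 * N)))) by lia; rewrite tech5, tech5, IH.
        replace (S (S (2 * N))) with (2 * S N)%nat by lia.
        rewrite !interleave_even, !interleave_odd; simpl; ring. }
    (* The terms being nonnegative, the sum is extended to an odd last index, where both covers
       contribute the same number of terms. *)
    apply Rle_trans with (sum_f_R0 (fun k => interleave b b' k - interleave a a' k) (S (2 * N))).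
    + apply sum_incr_le; [lia|assumption].
    + rewrite E0; apply Rplus_le_compat; auto.
Qed.

Lemma null_set_union E E' : null_set E -> null_set E' -> null_set (fun s => E s \/ E' s).
Proof.
  intros H H' eps He; replace eps with (eps / 2 + eps / 2) by field.
  apply cover_le_union; [apply H|apply H']; lra.
Qed.

(** Compactness of the interval without subdivisions: the supremum of the points reached from [a] is
    itself reached, and its own neighbourhood leads beyond it unless it is [b]. The local hypothesis
    concerns only intervals that contain the tag [s], as a derivative at [s] provides. *)
Lemma interval_additive (Q : R -> R -> Prop) a b : a <= b ->
  (forall r s t, r <= s -> s <= t -> Q r s -> Q s t -> Q r t) ->
  (forall s, a <= s <= b -> exists h, 0 < h /\ forall r r',
     a <= r -> r <= s -> s <= r' -> r' <= b -> r' - r < h -> Q r r') ->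
  Q a b.
Proof.
  intros Hab Hadd Hloc.
  set (A := fun s => a <= s <= b /\ Q a s).
  assert (Ha : A a).
  { destruct (Hloc a ltac:(lra)) as (h & Hh & H); split; [lra|apply H; lra]. }
  destruct (completeness A) as [s [Hub Hlub]].
  { exists b; intros r [Hr _]; lra. }
  { now exists a. }
  assert (Hs : a <= s <= b).
  { split; [now apply Hub|]; apply Hlub; intros r [Hr _]; lra. }
  destruct (Hloc s Hs) as (h & Hh & H).
  assert (Hr : exists r, A r /\ s - h / 2 < r).
  { apply NNPP; intros C; assert (B : is_upper_bound A (s - h / 2)).
    { intros r Hr; apply Rnot_lt_le; intros D; apply C; now exists r. }
    specialize (Hlub _ B); lra. }
  destruct Hr as (r & [Hr1 Hr2] & Hr3).
  assert (Hrs : r <= s) by (apply Hub; now split).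
  (* From [r > s - h / 2] to [s + h / 4] the length stays below [h]. *)
  set (s' := Rmin b (s + h / 4)).
  assert (Hs' : s <= s' <= b /\ s' <= s + h / 4 /\ (s' = b \/ s' = s + h / 4)).
  { unfold s', Rmin; destruct Rle_dec; lra. }
  assert (HA : A s').
  { split; [lra|]; apply Hadd with r; [lra|lra|assumption|apply H; lra]. }
  pose proof (Hub _ HA); destruct Hs' as (_ & _ & [E|E]); [rewrite <- E; apply HA|lra].
Qed.

Lemma fin_uniform n (Q : Fin.t n -> R -> Prop) :
  (forall i h h', 0 < h' <= h -> Q i h -> Q i h') ->
  (forall i, exists h, 0 < h /\ Q i h) -> exists h, 0 < h /\ forall i, Q i h.
Proof.
  induction n as [|n IH]; intros Hm H.
  - exists 1; split; [lra|]; intros i; apply (Fin.case0 (fun i => _) i).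
  - destruct (H Fin.F1) as (h1 & Hh1 & H1).
    destruct (IH (fun i => Q (Fin.FS i))) as (h2 & Hh2 & H2); [intros i; apply Hm|intros; apply H|].
    exists (Rmin h1 h2); split; [now apply Rmin_pos|].
    pose proof (Rmin_pos _ _ Hh1 Hh2).
    intros i; apply (Fin.caseS' i).
    + apply Hm with h1; [split; [assumption|apply Rmin_l]|assumption].
    + intros j; apply Hm with h2; [split; [assumption|apply Rmin_r]|apply H2].
Qed.

Lemma has_vderiv_expand n (g : R -> Vec n) s d e : has_vderiv g s d -> 0 < e ->
  exists h, 0 < h /\ forall r, Rabs r < h ->
    norm (vsub (vsub (g (s + r)) (g s)) (vscal r d)) <= e * Rabs r.
Proof.
  intros Hd He; pose proof (pos_INR n).
  assert (He' : 0 < e / (INR n + 1)) by (apply Rdiv_lt_0_compat; lra).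
  destruct (fin_uniform n (fun i h => forall r, Rabs r < h ->
      Rabs (g (s + r) i - g s i - r * d i) <= e / (INR n + 1) * Rabs r)) as (h & Hh & H1).
  - intros i h h' Hh Q r Hr; apply Q; lra.
  - intros i; destruct (Hd i _ He') as [h Hh]; exists h; split; [apply cond_pos|].
    intros r Hr; destruct (Req_dec r 0) as [->|Hr0].
    + rewrite Rplus_0_r, Rabs_R0.
      replace (g s i - g s i - 0 * d i) with 0 by ring; rewrite Rabs_R0; lra.
    + specialize (Hh r Hr0 Hr).
      replace (g (s + r) i - g s i - r * d i) with (((g (s + r) i - g s i) / r - d i) * r)
        by (field; assumption).
      rewrite Rabs_mult; pose proof (Rabs_pos r); nra.
  - exists h; split; [assumption|]; intros r Hr.
    eapply Rle_trans.
    + apply norm_le_coord; intros i; unfold vsub, vscal; apply (H1 i r Hr).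
    + pose proof (Rabs_pos r); replace (INR n * (e / (INR n + 1) * Rabs r)) with
        (e * Rabs r - e / (INR n + 1) * Rabs r) by (field; lra).
      assert (0 <= e / (INR n + 1) * Rabs r) by (apply Rmult_le_pos; lra); lra.
Qed.

Definition lipschitz_on {n} (a b : R) (g : R -> Vec n) (M : R) :=
  forall r s, a <= r -> r <= s -> s <= b -> norm (vsub (g s) (g r)) <= M * (s - r).

Lemma nonoverlapping_app (l l' : list (R * R)) s :
  nonoverlapping l -> nonoverlapping l' -> Forall (fun cd => snd cd <= s) l ->
  Forall (fun cd => s <= fst cd) l' -> nonoverlapping (l ++ l').
Proof.
  intros Hl Hl' Hs Hs'; induction l as [|[c d] l IH]; simpl in *; [assumption|].
  inversion_clear Hs; destruct Hl as (H1 & H2 & H3); repeat split; [assumption| |now apply IH].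
  apply Forall_app; split; [assumption|].
  eapply Forall_impl; [|exact Hs']; simpl in *; intros; lra.
Qed.

Lemma fold_right_sum_app (A : Type) (w : A -> R) l l' :
  fold_right (fun cd acc => w cd + acc) 0 (l ++ l') =
  fold_right (fun cd acc => w cd + acc) 0 l + fold_right (fun cd acc => w cd + acc) 0 l'.
Proof. induction l as [|c l IH]; simpl; [ring|rewrite IH; ring]. Qed.

(* Local increments are controlled by the derivative at a differentiability point, and are
   put on the list of exceptional intervals at any other point. *)
Lemma abs_cont_lipschitz n a b (g d : R -> Vec n) M :
  abs_cont_on a b g -> ae_on a b (fun s => has_vderiv g s (d s)) ->
  (forall s, a <= s <= b -> norm (d s) <= M) -> lipschitz_on a b g M.
Proof.
  intros Hac Hae Hd r0 s0 Hr0 Hrs0 Hs0.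
  apply Rnot_lt_le; intros C.
  set (gap := norm (vsub (g s0) (g r0)) - M * (s0 - r0)).
  assert (Hgap : 0 < gap) by (unfold gap; lra).
  (* The excess [gap] is refuted in two halves: the additional slope [e] costs at most one, the
     variation over the exceptional intervals less than the other. *)
  set (e := gap / (2 * (s0 - r0 + 1))).
  assert (He : 0 < e) by (unfold e; apply Rdiv_lt_0_compat; lra).
  destruct (Hac (gap / 2)) as (dl & Hdl & HAC); [lra|].
  destruct (null_set_gauge _ (dl / 2) Hae) as (mu & Hmon & Hrange & Hbad); [lra|].
  set (total := fold_right (fun (cd : R * R) acc => (snd cd - fst cd) + acc) 0).
  set (var := fold_right (fun (cd : R * R) acc => norm (vsub (g (snd cd)) (g (fst cd))) + acc) 0).
  (* Charging the total length of the list to an increment of [mu] makes [Q] additive, and in the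
     end keeps that length below the threshold [dl] of absolute continuity. *)
  set (Q := fun r s => exists l, nonoverlapping l /\
    Forall (fun cd => r <= fst cd /\ fst cd <= s /\ snd cd <= s /\ r <= snd cd) l /\
    total l <= mu s - mu r /\
    norm (vsub (g s) (g r)) <= (M + e) * (s - r) + var l).
  assert (HQ : Q r0 s0).
  { apply interval_additive; [assumption| |].
    - intros r s t Hrs Hst (l & H1 & H2 & H3 & H4) (l' & H1' & H2' & H3' & H4').
      exists (l ++ l'); repeat split.
      + apply nonoverlapping_app with s; try assumption.
        * eapply Forall_impl; [|exact H2]; simpl; tauto.
        * eapply Forall_impl; [|exact H2']; simpl; tauto.
      + apply Forall_app; split; [eapply Forall_impl; [|exact H2]|eapply Forall_impl; [|exact H2']];
          simpl; intros; lra.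
      + unfold total in *; rewrite fold_right_sum_app; lra.
      + unfold var in *; rewrite fold_right_sum_app.
        pose proof (norm_sub_triang _ (g s) (g t) (g r)); lra.
    - intros s Hs; destruct (classic (has_vderiv g s (d s))) as [Hg|Hb].
      + destruct (has_vderiv_expand _ _ _ _ e Hg He) as (h & Hh & Hexp).
        exists h; split; [assumption|]; intros r r' H1 H2 H3 H4 H5; exists nil.
        simpl; repeat split; [constructor|pose proof (Hmon r r' ltac:(lra)); lra|].
        assert (B : forall q, Rabs (q - s) < h -> norm (vsub (g q) (g s)) <= (M + e) * Rabs (q - s)).
        { intros q Hq; specialize (Hexp _ Hq); replace (s + (q - s)) with q in Hexp by ring.
          eapply Rle_trans; [apply (norm_le_sub _ _ (vscal (q - s) (d s)))|].
          rewrite norm_scal; specialize (Hd s ltac:(lra)); pose proof (Rabs_pos (q - s)); nra. }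
        pose proof (B r) as B1; pose proof (B r') as B2.
        rewrite Rabs_left1 in B1 by lra; rewrite Rabs_pos_eq in B2 by lra.
        rewrite norm_sub_sym in B1.
        pose proof (norm_sub_triang _ (g s) (g r') (g r)).
        specialize (B1 ltac:(lra)); specialize (B2 ltac:(lra)); lra.
      + destruct (Hbad s) as (h & Hh & Hm); [split; [lra|assumption]|].
        exists h; split; [assumption|]; intros r r' H1 H2 H3 H4 H5; exists ((r, r') :: nil).
        simpl; split; [split; [lra|split; [apply Forall_nil|exact I]]|].
        split; [apply Forall_cons; [simpl; lra|apply Forall_nil]|]; split.
        * specialize (Hm r r' ltac:(lra) ltac:(lra) ltac:(lra)); lra.
        * assert (0 <= M) by (eapply Rle_trans; [apply norm_nonneg|apply (Hd s); lra]).
          assert (0 <= (M + e) * (r' - r)) by (apply Rmult_le_pos; lra); lra. }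
  destruct HQ as (l & H1 & H2 & H3 & H4).
  assert (V : var l < gap / 2).
  { apply HAC; [assumption| |].
    - eapply Forall_impl; [|exact H2]; simpl; intros; lra.
    - fold total; pose proof (Hrange s0); pose proof (Hrange r0); lra. }
  assert (e * (s0 - r0) <= gap / 2).
  { unfold e; apply Rmult_le_reg_r with (s0 - r0 + 1); [lra|]; field_simplify; nra. }
  unfold gap in *; lra.
Qed.

Lemma lipschitz_abs_cont n a b (g : R -> Vec n) M : 0 <= M ->
  lipschitz_on a b g M -> abs_cont_on a b g.
Proof.
  intros HM Hg eps He; exists (eps / (M + 1)); split; [apply Rdiv_lt_0_compat; lra|].
  intros l Hl Hin Htot.
  assert (B : fold_right (fun cd acc => norm (vsub (g (snd cd)) (g (fst cd))) + acc) 0 l <=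
    (M + 1) * fold_right (fun cd acc => (snd cd - fst cd) + acc) 0 l).
  { clear Htot; induction l as [|[c d] l IH]; simpl in *; [lra|].
    inversion_clear Hin; destruct Hl as (H1 & H2 & H3); specialize (IH H3 H0).
    simpl in *; specialize (Hg c d ltac:(lra) H1 ltac:(lra)); lra. }
  eapply Rle_lt_trans; [exact B|]; apply Rmult_lt_compat_l with (r := M + 1) in Htot; [|lra].
  replace ((M + 1) * (eps / (M + 1))) with eps in Htot by (field; lra); exact Htot.
Qed.

(** * Closest points of the graph *)

(** It is squared so that half its gradient, [(l * (t - t'), x - x', y - y')], is the proximal
    normal at a closest point. *)
Definition wdist {n p} l t (x : Vec n) (y : Vec p) t' x' y' :=
  l * (t - t') ^ 2 + inner (vsub x x') (vsub x x') + inner (vsub y y') (vsub y y').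

Lemma wdist_bounds n p l t (x : Vec n) (y : Vec p) t' x' y' : 1 <= l ->
  (t - t') ^ 2 <= wdist l t x y t' x' y' /\ l * (t - t') ^ 2 <= wdist l t x y t' x' y' /\
  norm (vsub x x') * norm (vsub x x') <= wdist l t x y t' x' y' /\
  norm (vsub y y') * norm (vsub y y') <= wdist l t x y t' x' y' /\
  norm (vsub x x') * norm (vsub x x') + norm (vsub y y') * norm (vsub y y')
    <= wdist l t x y t' x' y'.
Proof.
  intros Hl; unfold wdist; pose proof (inner_nonneg _ (vsub x x')).
  pose proof (inner_nonneg _ (vsub y y')); rewrite !norm_sqr.
  pose proof (pow2_ge_0 (t - t')); repeat split; nra.
Qed.

Lemma wdist_nonneg n p l t (x : Vec n) (y : Vec p) t' x' y' : 1 <= l ->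
  0 <= wdist l t x y t' x' y'.
Proof.
  intros Hl; destruct (wdist_bounds _ _ l t x y t' x' y' Hl) as [H _].
  pose proof (pow2_ge_0 (t - t')); lra.
Qed.

(** Outer semicontinuity is sequential closedness of the graph over [[0, T]], so bounded pieces of
    it are sequentially compact; the three components are extracted one after the other. *)
Lemma graph_subseq n p T (F : R -> Vec n -> Vec p -> Prop) tk xk yk M : osc_on T F ->
  (forall k : nat, graph T F (tk k) (xk k) (yk k)) ->
  (forall k, norm (xk k) <= M) -> (forall k, norm (yk k) <= M) ->
  exists phi t x y, increasing_nat phi /\ graph T F t x y /\
    Un_cv (fun k => tk (phi k)) t /\ vcv (fun k => xk (phi k)) x /\ vcv (fun k => yk (phi k)) y.
Proof.
  intros Hosc Hg Hx Hy.
  destruct (bolzano_weierstrass_R tk (Rabs T)) as (p1 & t & P1 & Ht).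
  { intros k; destruct (Hg k) as [H _]; rewrite !Rabs_pos_eq; lra. }
  destruct (bolzano_weierstrass _ (fun k => xk (p1 k)) M) as (p2 & x & P2 & Hx'); [intros; apply Hx|].
  destruct (bolzano_weierstrass _ (fun k => yk (p1 (p2 k))) M) as (p3 & y & P3 & Hy');
    [intros; apply Hy|].
  set (phi := fun k => p1 (p2 (p3 k))).
  assert (Ht' : Un_cv (fun k => tk (phi k)) t).
  { apply (Un_cv_subseq (fun k => tk (p1 k)) t (fun k => p2 (p3 k))); [|assumption].
    now apply increasing_nat_comp. }
  assert (Hx'' : vcv (fun k => xk (phi k)) x)
    by (apply (vcv_subseq _ (fun k => xk (p1 (p2 k))) x p3); assumption).
  assert (Hin : 0 <= t <= T).
  { split; apply Rnot_lt_le; intros C.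
    - destruct (Ht' (- t) ltac:(lra)) as [N HN]; specialize (HN N (le_n N)).
      destruct (Hg (phi N)); apply Rabs_def2 in HN; lra.
    - destruct (Ht' (t - T) ltac:(lra)) as [N HN]; specialize (HN N (le_n N)).
      destruct (Hg (phi N)); apply Rabs_def2 in HN; lra. }
  exists phi, t, x, y; repeat split; try assumption; try apply Hin.
  - unfold phi; apply (increasing_nat_comp p1 (fun k => p2 (p3 k))); [assumption|].
    now apply increasing_nat_comp.
  - apply Hosc; [assumption|]; exists (fun k => tk (phi k)), (fun k => xk (phi k)), (fun k => yk (phi k)).
    repeat split; try assumption; apply Hg.
Qed.

Lemma norm_sub_cv n (x l : Vec n) xk : vcv xk l ->
  Un_cv (fun k => norm (vsub x (xk k))) (norm (vsub x l)).
Proof.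
  intros H e He; rewrite vcv_iff in H; destruct (H e He) as [N HN]; exists N; intros k Hk.
  specialize (HN k Hk); pose proof (norm_sub_triang _ l x (xk k)).
  pose proof (norm_sub_triang _ (xk k) x l); rewrite (norm_sub_sym _ l (xk k)) in *.
  apply Rabs_def1; lra.
Qed.

Lemma wdist_cv n p l t (x : Vec n) (y : Vec p) tk xk yk t' x' y' :
  Un_cv tk t' -> vcv xk x' -> vcv yk y' ->
  Un_cv (fun k => wdist l t x y (tk k) (xk k) (yk k)) (wdist l t x y t' x' y').
Proof.
  intros Ht Hx Hy; unfold wdist; simpl.
  assert (Hc : forall c, Un_cv (fun _ => c) c).
  { intros c e He; exists O; intros; unfold Rdist; now rewrite Rminus_diag, Rabs_R0. }
  assert (Hn : forall q (z : Vec q) zk z', vcv zk z' ->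
    Un_cv (fun k => inner (vsub z (zk k)) (vsub z (zk k))) (inner (vsub z z') (vsub z z'))).
  { intros q z zk z' Hz; rewrite <- norm_sqr.
    eapply Un_cv_ext; [intros k; apply norm_sqr|]; apply CV_mult; now apply norm_sub_cv. }
  repeat apply CV_plus; try now apply Hn.
  repeat apply CV_mult; try apply Hc; apply CV_minus; try apply Hc; assumption.
Qed.

Definition closest {n p} T (F : R -> Vec n -> Vec p -> Prop) l t x y tz xz yz :=
  graph T F tz xz yz /\ forall t' x' y', graph T F t' x' y' ->
    wdist l t x y tz xz yz <= wdist l t x y t' x' y'.

Lemma closest_exists n p T (F : R -> Vec n -> Vec p -> Prop) l t x y t0 x0 y0 :
  osc_on T F -> 1 <= l -> graph T F t0 x0 y0 ->
  exists tz xz yz, closest T F l t x y tz xz yz.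
Proof.
  intros Hosc Hl H0.
  (* [completeness] yields suprema, so the distances are negated and [- s] is their infimum. *)
  set (A := fun r => exists t' x' y', graph T F t' x' y' /\ r = - wdist l t x y t' x' y').
  destruct (completeness A) as [s [Hub Hlub]].
  { exists 0; intros r (t' & x' & y' & _ & ->); pose proof (wdist_nonneg _ _ l t x y t' x' y' Hl); lra. }
  { exists (- wdist l t x y t0 x0 y0), t0, x0, y0; now split. }
  assert (Hk : forall k : nat, exists z : R * Vec n * Vec p,
    graph T F (fst (fst z)) (snd (fst z)) (snd z) /\
    wdist l t x y (fst (fst z)) (snd (fst z)) (snd z) <= - s + / (INR k + 1)).
  { intros k; assert (Hk : 0 < / (INR k + 1)) by (apply Rinv_0_lt_compat; pose proof (pos_INR k); lra).
    apply NNPP; intros C.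
    assert (B : is_upper_bound A (s - / (INR k + 1))).
    { intros r (t' & x' & y' & G & ->); apply Rnot_lt_le; intros D; apply C.
      exists (t', x', y'); simpl; split; [assumption|lra]. }
    specialize (Hlub _ B); lra. }
  apply functional_choice in Hk; destruct Hk as [z Hz].
  set (B := - s + 1).
  assert (HB : forall k, wdist l t x y (fst (fst (z k))) (snd (fst (z k))) (snd (z k)) <= B).
  { intros k; destruct (Hz k) as [_ H]; unfold B.
    assert (/ (INR k + 1) <= 1); [|lra].
    rewrite <- Rinv_1; apply Rinv_le_contravar; [lra|]; pose proof (pos_INR k); lra. }
  assert (HB0 : 0 <= B) by (eapply Rle_trans; [apply wdist_nonneg, Hl|apply (HB O)]).
  (* From [r * r <= B] follows [r <= B + 1], which bounds the minimizing sequence without a square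
     root. *)
  destruct (graph_subseq _ _ T F (fun k => fst (fst (z k))) (fun k => snd (fst (z k)))
    (fun k => snd (z k)) (norm x + norm y + (B + 1)) Hosc) as (phi & tz & xz & yz & Hp & G & Ct & Cx & Cy).
  { intros k; apply Hz. }
  { intros k; pose proof (norm_nonneg _ y); pose proof (norm_le_sub _ (snd (fst (z k))) x) as N1.
    destruct (wdist_bounds _ _ l t x y (fst (fst (z k))) (snd (fst (z k))) (snd (z k)) Hl)
      as (_ & _ & B1 & _).
    specialize (HB k); rewrite norm_sub_sym in N1.
    pose proof (norm_nonneg _ (vsub x (snd (fst (z k))))); nra. }
  { intros k; pose proof (norm_nonneg _ x); pose proof (norm_le_sub _ (snd (z k)) y) as N1.
    destruct (wdist_bounds _ _ l t x y (fst (fst (z k))) (snd (fst (z k))) (snd (z k)) Hl)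
      as (_ & _ & _ & B1 & _).
    specialize (HB k); rewrite norm_sub_sym in N1.
    pose proof (norm_nonneg _ (vsub y (snd (z k)))); nra. }
  exists tz, xz, yz; split; [assumption|]; intros t' x' y' G'.
  apply Rle_trans with (- s).
  - apply Rnot_lt_le; intros C.
    pose proof (wdist_cv _ _ l t x y _ _ _ _ _ _ Ct Cx Cy) as Cw; simpl in Cw.
    set (gap := wdist l t x y tz xz yz - - s) in *.
    assert (Hg : 0 < gap) by (unfold gap; lra).
    destruct (Cw (gap / 2) ltac:(lra)) as [N HN].
    destruct (archimed_cor1 (gap / 2) ltac:(lra)) as [N' [HN' HN0]].
    specialize (HN (max N N') ltac:(lia)); apply Rabs_def2 in HN.
    destruct (Hz (phi (max N N'))) as [_ H].
    assert (/ (INR (phi (max N N')) + 1) <= / INR N').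
    { apply Rinv_le_contravar; [now apply lt_0_INR|].
      assert (N' <= phi (max N N'))%nat by (pose proof (increasing_nat_ge phi Hp (max N N')); lia).
      pose proof (le_INR _ _ H1); lra. }
    unfold gap in *; lra.
  - assert (- wdist l t x y t' x' y' <= s); [|lra].
    apply Hub; exists t', x', y'; now split.
Qed.

(* [h] may be negative. *)
Lemma wdist_step n p l t (x : Vec n) (y : Vec p) tz xz yz h dx dy a b e M : 1 <= l -> 0 <= e ->
  norm a <= M -> norm b <= M ->
  norm (vsub dx (vscal h a)) <= e * Rabs h -> norm (vsub dy (vscal h b)) <= e * Rabs h ->
  wdist l (t + h) (vadd x dx) (vadd y dy) tz xz yz <=
    wdist l t x y tz xz yz
    + 2 * h * (l * (t - tz) + inner (vsub x xz) a + inner (vsub y yz) b)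
    + Rabs h * e * (2 + wdist l t x y tz xz yz) + h ^ 2 * (l + 2 * (M + e) ^ 2).
Proof.
  intros Hl He Ha Hb Hx Hy.
  assert (Hone : forall q (z z' d v : Vec q), norm v <= M -> norm (vsub d (vscal h v)) <= e * Rabs h ->
    inner (vsub (vadd z d) z') (vsub (vadd z d) z') <=
    inner (vsub z z') (vsub z z') + 2 * h * inner (vsub z z') v
     + Rabs h * e * (1 + inner (vsub z z') (vsub z z')) + h ^ 2 * (M + e) ^ 2).
  { intros q z z' d v Hv Hd.
    set (w := vsub z z'); set (r := vsub d (vscal h v)) in *.
    replace (vsub (vadd z d) z') with (vadd w d) by (unfold w; vec_ext).
    rewrite inner_add_l, !inner_add_r, (inner_sym _ d w).
    assert (E : inner w d = h * inner w v + inner w r).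
    { rewrite <- inner_scal_r, <- inner_add_r; f_equal; unfold r; vec_ext. }
    pose proof (cauchy_schwarz _ w r) as CS; apply Rabs_le_between in CS.
    pose proof (norm_nonneg _ w); pose proof (norm_nonneg _ r); pose proof (Rabs_pos h) as Hh.
    assert (Hdn : norm d <= Rabs h * (M + e)).
    { replace d with (vadd (vscal h v) r) by (unfold r; vec_ext).
      eapply Rle_trans; [apply norm_add|]; rewrite norm_scal.
      apply Rmult_le_compat_l with (r := Rabs h) in Hv; [|assumption]; lra. }
    pose proof (norm_nonneg _ d).
    assert (Hdd : inner d d <= h ^ 2 * (M + e) ^ 2).
    { rewrite <- norm_sqr; rewrite <- (pow2_abs h).
      replace (Rabs h ^ 2 * (M + e) ^ 2) with ((Rabs h * (M + e)) * (Rabs h * (M + e))) by ring.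
      apply Rmult_le_compat; assumption. }
    (* Young's inequality in the form [2 * W * N <= 2 * W * q0 <= q0 * (1 + W ^ 2)]; the error
       becomes linear in the squared distance. *)
    assert (Hw : 2 * (norm w * norm r) <= Rabs h * e * (1 + inner w w)).
    { rewrite <- norm_sqr; rewrite (Rmult_comm e) in Hd; fold r in Hd.
      set (q0 := Rabs h * e) in *; set (W := norm w) in *; set (N := norm r) in *.
      assert (0 <= q0 * (1 - W) ^ 2) by (apply Rmult_le_pos; [lra|apply pow2_ge_0]).
      assert (0 <= W * (q0 - N)) by (apply Rmult_le_pos; lra); lra. }
    rewrite E; lra. }
  pose proof (Hone _ x xz dx a Ha Hx) as H1; pose proof (Hone _ y yz dy b Hb Hy) as H2.
  unfold wdist; set (X := inner (vsub x xz) (vsub x xz)) in *.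
  set (Y := inner (vsub y yz) (vsub y yz)) in *.
  assert (0 <= Rabs h * e * (l * (t - tz) ^ 2)).
  { apply Rmult_le_pos; [apply Rmult_le_pos; [apply Rabs_pos|assumption]|].
    apply Rmult_le_pos; [lra|apply pow2_ge_0]. }
  set (Q := Rabs h * e) in *; nra.
Qed.

(** * Differential equations with a constant control *)

Lemma has_vderiv_sub n (g g' : R -> Vec n) s d d' : has_vderiv g s d -> has_vderiv g' s d' ->
  has_vderiv (fun r => vsub (g r) (g' r)) s (vsub d d').
Proof.
  intros H H' i; exact (derivable_pt_lim_minus (fun r => g r i) (fun r => g' r i) s _ _ (H i) (H' i)).
Qed.

Lemma has_vderiv_linear n s (a : Vec n) : has_vderiv (fun r => vscal r a) s a.
Proof.
  intros i e He; exists (mkposreal 1 Rlt_0_1); intros h Hh _; unfold vscal.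
  replace (((s + h) * a i - s * a i) / h - a i) with 0 by (field; assumption).
  now rewrite Rabs_R0.
Qed.

Lemma has_vderiv_shift n (g : R -> Vec n) s t d :
  has_vderiv g (s - t) d -> has_vderiv (fun r => g (r - t)) s d.
Proof.
  intros H i e He; destruct (H i e He) as [h Hh]; exists h; intros r Hr Hr'.
  replace (s + r - t) with (s - t + r) by ring; now apply Hh.
Qed.

Lemma has_vderiv_ext_loc n (g g' : R -> Vec n) s d h0 : 0 < h0 ->
  (forall r, Rabs (r - s) < h0 -> g' r = g r) -> has_vderiv g s d -> has_vderiv g' s d.
Proof.
  intros Hh0 E H i e He; destruct (H i e He) as [h Hh].
  assert (Hm : 0 < Rmin h h0) by (apply Rmin_pos; [apply cond_pos|assumption]).
  exists (mkposreal _ Hm); simpl; intros r Hr Hr'.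
  pose proof (Rmin_l h h0); pose proof (Rmin_r h h0).
  rewrite !E by (rewrite ?Rminus_diag, ?Rabs_R0; try lra;
    replace (s + r - s) with r by ring; lra).
  apply Hh; [assumption|lra].
Qed.

(** Mean value inequality: around every point the slope is at most [M + e], and these bounds add up
    along the interval. *)
Lemma deriv_lipschitz n a b (g d : R -> Vec n) M :
  (forall s, a <= s <= b -> has_vderiv g s (d s)) ->
  (forall s, a <= s <= b -> norm (d s) <= M) -> lipschitz_on a b g M.
Proof.
  intros Hg Hd r0 s0 Hr0 Hrs0 Hs0; apply Rnot_lt_le; intros C.
  set (gap := norm (vsub (g s0) (g r0)) - M * (s0 - r0)).
  assert (Hgap : 0 < gap) by (unfold gap; lra).
  set (e := gap / (2 * (s0 - r0 + 1))).
  assert (He : 0 < e) by (unfold e; apply Rdiv_lt_0_compat; lra).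
  assert (HQ : norm (vsub (g s0) (g r0)) <= (M + e) * (s0 - r0)).
  { apply (interval_additive (fun r s => norm (vsub (g s) (g r)) <= (M + e) * (s - r)));
      [assumption| |].
    - intros r s t Hrs Hst H H'; pose proof (norm_sub_triang _ (g s) (g t) (g r)); lra.
    - intros s Hs; destruct (has_vderiv_expand _ _ _ _ e (Hg s ltac:(lra)) He) as (h & Hh & Hexp).
      exists h; split; [assumption|]; intros r r' H1 H2 H3 H4 H5.
      assert (B : forall q, Rabs (q - s) < h -> norm (vsub (g q) (g s)) <= (M + e) * Rabs (q - s)).
      { intros q Hq; specialize (Hexp _ Hq); replace (s + (q - s)) with q in Hexp by ring.
        eapply Rle_trans; [apply (norm_le_sub _ _ (vscal (q - s) (d s)))|].
        rewrite norm_scal; specialize (Hd s ltac:(lra)); pose proof (Rabs_pos (q - s)); nra. }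
      pose proof (B r) as B1; pose proof (B r') as B2.
      rewrite Rabs_left1 in B1 by lra; rewrite Rabs_pos_eq in B2 by lra.
      rewrite norm_sub_sym in B1.
      pose proof (norm_sub_triang _ (g s) (g r') (g r)).
      specialize (B1 ltac:(lra)); specialize (B2 ltac:(lra)); lra. }
  assert (e * (s0 - r0) <= gap / 2).
  { unfold e; apply Rmult_le_reg_r with (s0 - r0 + 1); [lra|]; field_simplify; nra. }
  unfold gap in *; lra.
Qed.

(** Under a constant control the integrands are Lipschitz along Lipschitz curves, so the Riemann
    integral of each coordinate supplies a primitive. *)
Lemma primitive_exists n (g : R -> Vec n) C :
  (forall r s, norm (vsub (g r) (g s)) <= C * Rabs (r - s)) ->
  exists G : R -> Vec n, G 0 = vzero /\ forall s, has_vderiv G s (g s).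
Proof.
  intros Hg.
  assert (Hc : forall i s, continuous (fun r => g r i) s).
  { intros i s; apply continuity_pt_filterlim; intros e He.
    exists (e / (Rabs C + 1)); pose proof (Rabs_pos C); split; [apply Rdiv_lt_0_compat; lra|].
    intros r [_ Hr]; simpl in *; unfold Rdist in *.
    eapply Rle_lt_trans; [apply (norm_coord _ (vsub (g r) (g s)) i)|].
    eapply Rle_lt_trans; [apply Hg|].
    pose proof (Rle_abs C); pose proof (Rabs_pos (r - s)).
    apply Rle_lt_trans with ((Rabs C + 1) * Rabs (r - s)); [nra|].
    apply Rmult_lt_compat_l with (r := Rabs C + 1) in Hr; [|lra].
    replace ((Rabs C + 1) * (e / (Rabs C + 1))) with e in Hr by (field; lra); exact Hr. }
  exists (fun s i => RInt (fun r => g r i) 0 s); split.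
  - apply functional_extensionality; intros i; exact (RInt_point 0 (fun r => g r i)).
  - intros s i; apply is_derive_Reals.
    apply (is_derive_RInt (fun r => g r i) _ 0 s); [|apply Hc].
    apply filter_forall; intros r.
    apply (@RInt_correct R_CompleteNormedModule), (@ex_RInt_continuous R_CompleteNormedModule).
    intros; apply Hc.
Qed.

Lemma geometric_limit n (x : nat -> Vec n) C :
  (forall k, norm (vsub (x (S k)) (x k)) <= C * (/ 2) ^ k) ->
  exists l, forall k, norm (vsub l (x k)) <= 2 * C * (/ 2) ^ k.
Proof.
  intros H.
  assert (HC : 0 <= C).
  { specialize (H O); simpl in H; pose proof (norm_nonneg _ (vsub (x 1%nat) (x 0%nat))); lra. }
  assert (Hp : forall k, 0 < (/ 2) ^ k) by (intros; apply pow_lt; lra).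
  (* Subtracting the remaining tail makes the bound stable under the induction on [j]. *)
  assert (Hb : forall k j, norm (vsub (x (k + j)%nat) (x k)) <= 2 * C * (/ 2) ^ k - 2 * C * (/ 2) ^ (k + j)).
  { intros k j; induction j as [|j IH].
    - rewrite Nat.add_0_r, norm_sub_self; lra.
    - rewrite Nat.add_succ_r; pose proof (norm_sub_triang _ (x (k + j)%nat) (x (S (k + j))) (x k)).
      specialize (H (k + j)%nat); simpl ((/ 2) ^ S (k + j)); lra. }
  assert (Hb' : forall k j, (k <= j)%nat -> norm (vsub (x j) (x k)) <= 2 * C * (/ 2) ^ k).
  { intros k j Hj; specialize (Hb k (j - k)%nat); replace (k + (j - k))%nat with j in Hb by lia.
    specialize (Hp j); nra. }
  (* A cluster point suffices: the Cauchy bound passes to it along the extracted indices beyond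
     [k]. *)
  destruct (bolzano_weierstrass _ x (norm (x O) + 2 * C)) as (phi & l & Hphi & Hl).
  { intros k; specialize (Hb' O k ltac:(lia)); simpl in Hb'.
    pose proof (norm_le_sub _ (x k) (x O)); lra. }
  exists l; intros k; apply Rnot_lt_le; intros D; rewrite vcv_iff in Hl.
  destruct (Hl (norm (vsub l (x k)) - 2 * C * (/ 2) ^ k)) as [N HN]; [lra|].
  specialize (HN (max k N) ltac:(lia)).
  pose proof (increasing_nat_ge phi Hphi (max k N)).
  specialize (Hb' k (phi (max k N)) ltac:(lia)).
  pose proof (norm_sub_triang _ (x (phi (max k N))) l (x k)).
  rewrite (norm_sub_sym _ l (x (phi (max k N)))) in *; lra.
Qed.

Lemma lipschitz_on_abs n (g : R -> Vec n) M : (forall a b, lipschitz_on a b g M) ->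
  forall r s, norm (vsub (g r) (g s)) <= M * Rabs (r - s).
Proof.
  intros H r s; destruct (Rle_lt_dec r s) as [D|D].
  - rewrite norm_sub_sym, Rabs_left1 by lra; specialize (H r s r s ltac:(lra) D ltac:(lra)); lra.
  - rewrite Rabs_pos_eq by lra; apply (H s r s r); lra.
Qed.

Lemma pow_half_small C e : 0 <= C -> 0 < e -> exists k, C * (/ 2) ^ k < e.
Proof.
  intros HC He; destruct (pow_lt_1_zero (/ 2)) with (y := e / (C + 1)) as [N HN].
  - rewrite Rabs_pos_eq; lra.
  - apply Rdiv_lt_0_compat; lra.
  - exists N; specialize (HN N (le_n N)).
    assert (0 < (/ 2) ^ N) by (apply pow_lt; lra); rewrite Rabs_pos_eq in HN by lra.
    apply Rmult_lt_compat_l with (r := C + 1) in HN; [|lra].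
    replace ((C + 1) * (e / (C + 1))) with e in HN by (field; lra); lra.
Qed.

(** Picard iteration, halving the error at each round because [h * K <= / 2]. Since [has_vderiv] is
    two-sided, the solution must also be defined around the ends of [[0, h]]; hence all iterates
    live on the whole line, while convergence is only claimed on [[0, h]]. *)
Lemma ode_local n (F : Vec n -> Vec n) K M h x0 : 0 <= K ->
  (forall x y, norm (vsub (F x) (F y)) <= K * norm (vsub x y)) -> (forall x, norm (F x) <= M) ->
  0 < h -> h * K <= / 2 ->
  exists x : R -> Vec n, x 0 = x0 /\ (forall s, 0 <= s <= h -> has_vderiv x s (F (x s))) /\
    forall a b, lipschitz_on a b x M.
Proof.
  intros HK HF HM Hh HhK.
  set (good := fun x : R -> Vec n => forall a b, lipschitz_on a b x M).
  (* The premise [good x] stands inside the existential so that choice gives an operator on all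
     curves. *)
  assert (Hpic : forall x, exists y, good x ->
    y 0 = x0 /\ (forall s, has_vderiv y s (F (x s))) /\ good y).
  { intros x; destruct (classic (good x)) as [Hx|Hx]; [|exists x; intros; contradiction].
    destruct (primitive_exists _ (fun s => F (x s)) (K * M)) as (G & G0 & HG).
    { intros r s; eapply Rle_trans; [apply HF|].
      rewrite Rmult_assoc; apply Rmult_le_compat_l; [assumption|now apply lipschitz_on_abs]. }
    assert (Hy : forall s, has_vderiv (fun s => vadd x0 (G s)) s (F (x s))).
    { intros s i; replace (F (x s) i) with (0 + F (x s) i) by ring.
      exact (derivable_pt_lim_plus (fct_cte (x0 i)) (fun r => G r i) s _ _
        (derivable_pt_lim_const (x0 i) s) (HG s i)). }
    exists (fun s => vadd x0 (G s)); intros _; repeat split; [rewrite G0; vec_ext|assumption|].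
    intros a b; apply deriv_lipschitz with (fun s => F (x s)); auto. }
  apply functional_choice in Hpic; destruct Hpic as [Pic HPic].
  set (X := fun k => Nat.iter k Pic (fun _ => x0)).
  assert (HM0 : 0 <= M) by (eapply Rle_trans; [apply norm_nonneg|apply (HM x0)]).
  assert (HX : forall k, good (X k)).
  { intros k; induction k as [|k IH]; [|now apply HPic].
    intros a b r s _ Hrs _; simpl; rewrite norm_sub_self; nra. }
  assert (HXs : forall k s, has_vderiv (X (S k)) s (F (X k s))) by (intros; now apply HPic).
  assert (HX0 : forall k, X k 0 = x0).
  { intros [|k]; [reflexivity|now apply HPic]. }
  assert (Hstep : forall k s, 0 <= s <= h ->
    norm (vsub (X (S k) s) (X k s)) <= M * h * (/ 2) ^ k).
  { intros k; induction k as [|k IH]; intros s Hs.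
    - simpl pow; rewrite Rmult_1_r; change (X 0%nat s) with x0; rewrite <- (HX0 1%nat).
      specialize (HX 1%nat 0 s 0 s ltac:(lra) ltac:(lra) ltac:(lra)); nra.
    - assert (Lp : lipschitz_on 0 h (fun r => vsub (X (S (S k)) r) (X (S k) r))
        (K * (M * h * (/ 2) ^ k))).
      { apply deriv_lipschitz with (fun r => vsub (F (X (S k) r)) (F (X k r))).
        - intros r _; now apply has_vderiv_sub.
        - intros r Hr; eapply Rle_trans; [apply HF|]; now apply Rmult_le_compat_l, IH. }
      specialize (Lp 0 s ltac:(lra) ltac:(lra) ltac:(lra)); cbv beta in Lp.
      rewrite !HX0 in Lp.
      replace (vsub (vsub (X (S (S k)) s) (X (S k) s)) (vsub x0 x0)) with
        (vsub (X (S (S k)) s) (X (S k) s)) in Lp by vec_ext.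
      eapply Rle_trans; [exact Lp|]; simpl pow.
      assert (0 <= M * h * (/ 2) ^ k) by (apply Rmult_le_pos; [nra|apply pow_le; lra]).
      set (q := M * h * (/ 2) ^ k) in *.
      replace (M * h * (/ 2 * (/ 2) ^ k)) with (/ 2 * q) by (unfold q; ring).
      apply Rle_trans with (h * K * q); [|now apply Rmult_le_compat_r].
      replace (h * K * q) with (K * q * h) by ring; apply Rmult_le_compat_l; [nra|lra]. }
  (* Clamping to [[0, h]], where the iterates converge, extends the limit to a Lipschitz curve on
     the line, to which [Pic] applies once more. *)
  set (cl := fun s => Rmax 0 (Rmin s h)).
  assert (Hcl : forall s, 0 <= cl s <= h) by (intros; unfold cl, Rmax, Rmin; repeat destruct Rle_dec; lra).
  assert (Hlim : forall s, exists l, forall k, norm (vsub l (X k (cl s))) <= 2 * (M * h) * (/ 2) ^ k).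
  { intros s; apply geometric_limit; intros k; apply Hstep, Hcl. }
  apply functional_choice in Hlim; destruct Hlim as [phi Hphi].
  assert (Hsmall : forall C v, 0 <= C -> (forall k, v <= C * (/ 2) ^ k) -> v <= 0).
  { intros C v HC Hv; apply Rnot_lt_le; intros D.
    destruct (pow_half_small C v HC D) as [k Hk]; specialize (Hv k); lra. }
  assert (Gphi : good phi).
  { intros a b r s _ Hrs _.
    assert (Hc : cl r <= cl s /\ cl s - cl r <= s - r)
      by (unfold cl, Rmax, Rmin; repeat destruct Rle_dec; lra).
    assert (norm (vsub (phi s) (phi r)) - M * (s - r) <= 0); [|lra].
    apply Hsmall with (4 * (M * h)); [nra|]; intros k.
    specialize (HX k (cl r) (cl s) (cl r) (cl s) ltac:(lra) ltac:(lra) ltac:(lra)).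
    pose proof (Hphi r k) as P1; pose proof (Hphi s k) as P2; rewrite norm_sub_sym in P1.
    pose proof (norm_sub_triang _ (X k (cl s)) (phi s) (phi r)).
    pose proof (norm_sub_triang _ (X k (cl r)) (X k (cl s)) (phi r)); nra. }
  destruct (HPic phi Gphi) as (Y0 & HY & GY).
  set (Y := Pic phi) in *.
  exists Y; split; [assumption|]; split; [|assumption].
  (* The image [Y] solves the equation driven by [phi]; both are close to [X (S k)] for every [k],
     so on [[0, h]] they coincide and [Y] is a fixed point there. *)
  assert (E : forall s, 0 <= s <= h -> Y s = phi s).
  { intros s Hs; apply norm_sub_eq, Hsmall with (2 * (M * h) + 2 * (M * h)); [nra|]; intros k.
    assert (Hid : forall r, 0 <= r <= h -> cl r = r)
      by (intros; unfold cl, Rmax, Rmin; repeat destruct Rle_dec; lra).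
    assert (Lp : lipschitz_on 0 h (fun r => vsub (Y r) (X (S k) r)) (K * (2 * (M * h) * (/ 2) ^ k))).
    { apply deriv_lipschitz with (fun r => vsub (F (phi r)) (F (X k r))).
      - intros r _; now apply has_vderiv_sub.
      - intros r Hr; eapply Rle_trans; [apply HF|]; apply Rmult_le_compat_l; [assumption|].
        rewrite <- (Hid r Hr) at 2; apply Hphi. }
    specialize (Lp 0 s ltac:(lra) ltac:(lra) ltac:(lra)); cbv beta in Lp.
    rewrite HX0, Y0 in Lp.
    replace (vsub (vsub (Y s) (X (S k) s)) (vsub x0 x0)) with (vsub (Y s) (X (S k) s)) in Lp by vec_ext.
    pose proof (Hphi s (S k)) as P1; rewrite (Hid s Hs), norm_sub_sym in P1; simpl pow in P1.
    pose proof (norm_sub_triang _ (X (S k) s) (Y s) (phi s)) as Tr.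
    assert (0 <= M * h * (/ 2) ^ k) by (apply Rmult_le_pos; [nra|apply pow_le; lra]).
    set (q := M * h * (/ 2) ^ k) in *.
    replace (2 * (M * h) * (/ 2 * (/ 2) ^ k)) with q in P1 by (unfold q; field).
    replace ((2 * (M * h) + 2 * (M * h)) * (/ 2) ^ k) with (4 * q) by (unfold q; ring).
    replace (K * (2 * (M * h) * (/ 2) ^ k) * (s - 0)) with (2 * q * (s * K)) in Lp by (unfold q; ring).
    assert (s * K <= / 2) by nra; nra. }
  intros s Hs; rewrite (E s Hs); apply HY.
Qed.

(** * Measurability of piecewise constant controls *)

Lemma sum_first r N : sum_f_R0 (fun k => match k with O => r | _ => 0 end) N = r.
Proof. induction N as [|N IH]; simpl; [reflexivity|rewrite IH; ring]. Qed.

Lemma cover_le_interval a b : a <= b -> cover_le (fun s => a < s < b) (b - a).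
Proof.
  intros Hab; exists (fun k => match k with O => a | _ => 0 end),
    (fun k => match k with O => b | _ => 0 end); repeat split.
  - intros [|k]; lra.
  - intros s Hs; exists O; assumption.
  - intros N; right; rewrite <- (sum_first (b - a) N); apply sum_eq; intros [|k] _; ring.
Qed.

Lemma cover_le_subset (E E' : R -> Prop) r : (forall s, E s -> E' s) -> cover_le E' r -> cover_le E r.
Proof. intros H (a & b & Hab & Hc & Hs); exists a, b; repeat split; auto. Qed.

Lemma null_set_point t : null_set (fun s => s = t).
Proof.
  intros e He; replace e with (t + e / 2 - (t - e / 2)) by field.
  apply cover_le_subset with (fun s => t - e / 2 < s < t + e / 2); [intros; lra|].
  apply cover_le_interval; lra.
Qed.

Lemma leb_measurable_ext (E E' : R -> Prop) : (forall s, E s <-> E' s) ->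
  leb_measurable E -> leb_measurable E'.
Proof.
  intros H HE e He; destruct (HE e He) as (G & HG & Hsub & Hc); exists G; repeat split; [assumption| |].
  - intros s Hs; now apply Hsub, H.
  - eapply cover_le_subset; [|exact Hc]; simpl; intros s Hs; now rewrite H.
Qed.

Lemma leb_measurable_union E E' : leb_measurable E -> leb_measurable E' ->
  leb_measurable (fun s => E s \/ E' s).
Proof.
  intros H H' e He; destruct (H (e / 2)) as (G & HG & Hsub & Hc); [lra|].
  destruct (H' (e / 2)) as (G' & HG' & Hsub' & Hc'); [lra|].
  exists (fun s => G s \/ G' s); repeat split.
  - intros s [Hs|Hs]; [destruct (HG s Hs) as (d & Hd & Q)|destruct (HG' s Hs) as (d & Hd & Q)];
      exists d; split; auto.
  - intros s [Hs|Hs]; auto.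
  - replace e with (e / 2 + e / 2) by field.
    eapply cover_le_subset; [|exact (cover_le_union _ _ _ _ Hc Hc')]; simpl; tauto.
Qed.

(** Cutting at a switching time is an intersection with an open half-line, which keeps the outer
    approximating set open. *)
Lemma leb_measurable_before E t : leb_measurable E -> leb_measurable (fun s => E s /\ s < t).
Proof.
  intros H e He; destruct (H e He) as (G & HG & Hsub & Hc).
  exists (fun s => G s /\ s < t); repeat split.
  - intros s [Hs Hst]; destruct (HG s Hs) as (d & Hd & Q); exists (Rmin d (t - s)).
    split; [apply Rmin_pos; lra|]; intros r Hr.
    pose proof (Rmin_l d (t - s)); pose proof (Rmin_r d (t - s)).
    split; [apply Q; lra|]; apply Rabs_def2 in Hr; lra.
  - apply Hsub, H0.
  - apply H0.
  - eapply cover_le_subset; [|exact Hc]; simpl; tauto.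
Qed.

Lemma leb_measurable_interval a b : leb_measurable (fun s => a <= s <= b).
Proof.
  intros e He; destruct (Rle_lt_dec a b) as [Hab|Hab].
  - exists (fun s => a - e / 2 < s < b + e / 2); repeat split; try lra.
    + intros s Hs; exists (Rmin (s - (a - e / 2)) (b + e / 2 - s)); split; [apply Rmin_pos; lra|].
      intros r Hr; pose proof (Rmin_l (s - (a - e / 2)) (b + e / 2 - s)).
      pose proof (Rmin_r (s - (a - e / 2)) (b + e / 2 - s)); apply Rabs_def2 in Hr; lra.
    + apply cover_le_subset with (fun s => a - e / 2 < s < a \/ b < s < b + e / 2).
      * intros s [H1 H2]; destruct (Rlt_le_dec s a); [left; lra|].
        destruct (Rlt_le_dec b s); [right; lra|exfalso; apply H2; lra].
      * pose proof (cover_le_union _ _ _ _ (cover_le_interval (a - e / 2) a ltac:(lra))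
          (cover_le_interval b (b + e / 2) ltac:(lra))) as C.
        replace (a - (a - e / 2) + (b + e / 2 - b)) with e in C by field; exact C.
  - exists (fun _ => False); repeat split; [intros s []|intros; lra|].
    apply cover_le_subset with (fun s => a < s < a + e); [tauto|].
    pose proof (cover_le_interval a (a + e) ltac:(lra)) as C.
    replace (a + e - a) with e in C by ring; exact C.
Qed.

Lemma leb_measurable_empty : leb_measurable (fun _ => False).
Proof.
  apply leb_measurable_ext with (fun s => 1 <= s <= 0); [intros; lra|apply leb_measurable_interval].
Qed.

Lemma admissible_const m T (U : Vec m -> Prop) v : U v -> admissible T U (fun _ => v).
Proof.
  intros Hv; repeat split; [auto|exists (norm v); intros; lra|].
  intros O _; destruct (classic (O v)) as [H|H].
  - apply leb_measurable_ext with (fun s => 0 <= s <= T); [tauto|apply leb_measurable_interval].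
  - apply leb_measurable_ext with (fun _ => False); [tauto|apply leb_measurable_empty].
Qed.

Definition switch {A} (t : R) (g g' : R -> A) (s : R) : A := if Rlt_dec s t then g s else g' s.

Lemma switch_lt A t (g g' : R -> A) s : s < t -> switch t g g' s = g s.
Proof. intros H; unfold switch; destruct Rlt_dec; [reflexivity|lra]. Qed.

Lemma switch_ge A t (g g' : R -> A) s : t <= s -> switch t g g' s = g' s.
Proof. intros H; unfold switch; destruct Rlt_dec; [lra|reflexivity]. Qed.

Lemma admissible_switch m T (U : Vec m -> Prop) u v t : 0 <= t ->
  admissible T U u -> U v -> admissible T U (switch t u (fun _ => v)).
Proof.
  intros Ht (Hu & [M HM] & Hm) Hv; repeat split.
  - intros s Hs; unfold switch; destruct Rlt_dec; auto.
  - exists (Rmax M (norm v)); intros s Hs; unfold switch; destruct Rlt_dec.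
    + eapply Rle_trans; [now apply HM|apply Rmax_l].
    + apply Rmax_r.
  - intros O HO.
    apply leb_measurable_ext with (fun s => ((0 <= s <= T /\ O (u s)) /\ s < t) \/ (t <= s <= T /\ O v)).
    + intros s; unfold switch; destruct (Rlt_dec s t); intuition lra.
    + apply leb_measurable_union; [apply leb_measurable_before; now apply Hm|].
      destruct (classic (O v)) as [H|H].
      * apply leb_measurable_ext with (fun s => t <= s <= T); [tauto|apply leb_measurable_interval].
      * apply leb_measurable_ext with (fun _ => False); [tauto|apply leb_measurable_empty].
Qed.

(** * Induction backward along an interval, and auxiliary estimates *)

(** Real induction from [b] down to [a]: the infimum of the points down to which [S] holds satisfies
    [S] by the limit hypothesis and, if it exceeded [a], would be passed by the step hypothesis.
    Points enter [A] negated to turn this infimum into a supremum. *)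
Lemma leftward_induction (S : R -> Prop) a b : a <= b -> S b ->
  (forall s, a <= s < b -> (forall r, s < r <= b -> S r) -> S s) ->
  (forall s, a < s <= b -> S s -> exists h, 0 < h /\ forall r, s - h < r < s -> a <= r -> S r) ->
  S a.
Proof.
  intros Hab Hb Hclosed Hstep.
  set (A := fun q => a <= - q <= b /\ forall r, - q <= r <= b -> S r).
  destruct (completeness A) as [q [Hub Hlub]].
  { exists (- a); intros r [H _]; lra. }
  { exists (- b); split; [lra|]; intros r Hr; replace r with b by lra; assumption. }
  assert (Hq : a <= - q <= b).
  { split.
    - assert (q <= - a); [|lra]; apply Hlub; intros r [H _]; lra.
    - assert (- b <= q); [|lra]; apply Hub; split; [lra|]; intros r Hr.
      replace r with b by lra; assumption. }
  assert (Hr : forall r, - q < r <= b -> S r).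
  { intros r Hr; apply NNPP; intros C.
    assert (B : is_upper_bound A (- r)).
    { intros s [H1 H2]; apply Rnot_lt_le; intros D; apply C, H2; lra. }
    specialize (Hlub _ B); lra. }
  assert (HS : S (- q)).
  { destruct (Rlt_le_dec (- q) b) as [H|H]; [now apply Hclosed|].
    replace (- q) with b by lra; assumption. }
  destruct (Rle_lt_or_eq_dec a (- q)) as [H|H]; [lra| |rewrite H; assumption].
  destruct (Hstep (- q) ltac:(lra) HS) as (h & Hh & Hs); exfalso.
  set (s := Rmax a (- q - h / 2)).
  assert (Hs' : a <= s /\ s < - q /\ - q - h < s) by (unfold s, Rmax; destruct Rle_dec; lra).
  assert (B : A (- s)).
  { split; [lra|]; intros r Hr'; rewrite Ropp_involutive in Hr'.
    destruct (Rlt_le_dec r (- q)) as [D|D]; [apply Hs; lra|].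
    destruct (Rle_lt_or_eq_dec _ _ D) as [D'|<-]; [apply Hr; lra|assumption]. }
  specialize (Hub _ B); lra.
Qed.

Lemma exp_monotone a b : a <= b -> exp a <= exp b.
Proof. intros [H| ->]; [left; now apply exp_increasing|lra]. Qed.

Lemma cone_add p (P : Vec p -> Prop) a b :
  vconvex_set P -> is_cone P -> P a -> P b -> P (vadd a b).
Proof.
  intros Hcv Hc Ha Hb.
  replace (vadd a b) with (vadd (vscal (1 / 2) (vscal 2 a)) (vscal (1 - 1 / 2) (vscal 2 b)))
    by (vec_ext; field).
  apply Hcv; [apply Hc; [assumption|lra]|apply Hc; [assumption|lra]|lra].
Qed.

(** This is [wdist_step] with zero velocities and error rate [M]. It relies on increments alone, and
    serves at times where no derivative is at hand and for limits in time. *)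
Lemma wdist_coarse n p l t (x : Vec n) (y : Vec p) tz xz yz h dx dy M R0 : 1 <= l -> 0 <= M ->
  Rabs h <= 1 -> norm dx <= M * Rabs h -> norm dy <= M * Rabs h ->
  wdist l t x y tz xz yz <= R0 ->
  wdist l (t + h) (vadd x dx) (vadd y dy) tz xz yz <=
    wdist l t x y tz xz yz + Rabs h * (2 * l + R0 + M * (2 + R0) + 2 * M ^ 2).
Proof.
  intros Hl HM Hh Hx Hy HR.
  assert (Z : forall q (v : Vec q), vsub v (vscal h vzero) = v) by (intros; vec_ext).
  pose proof (wdist_step _ _ l t x y tz xz yz h dx dy vzero vzero M 0 Hl HM) as St.
  rewrite !norm_zero, !Z, !inner_zero_r in St; specialize (St ltac:(lra) ltac:(lra) Hx Hy).
  destruct (wdist_bounds _ _ l t x y tz xz yz Hl) as (_ & B & _).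
  set (D := wdist l t x y tz xz yz) in *; pose proof (Rabs_pos h) as Hp.
  (* The linear time term is absorbed through [2 * Rabs r <= 1 + r ^ 2] with [r = t - tz], and
     [l * (t - tz) ^ 2] is part of the distance. *)
  assert (E1 : 2 * h * (l * (t - tz)) <= Rabs h * (l + R0)).
  { apply Rle_trans with (Rabs h * (l + l * (t - tz) ^ 2)); [|apply Rmult_le_compat_l; lra].
    pose proof (Rle_abs (h * (2 * (t - tz)))) as Q; rewrite Rabs_mult in Q.
    assert (Rabs (2 * (t - tz)) <= 1 + (t - tz) ^ 2) by
      (apply Rabs_le; pose proof (pow2_ge_0 (1 + (t - tz))); pose proof (pow2_ge_0 (1 - (t - tz))); lra).
    assert (h * (2 * (t - tz)) <= Rabs h * (1 + (t - tz) ^ 2)).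
    { eapply Rle_trans; [exact Q|now apply Rmult_le_compat_l]. }
    nra. }
  assert (E2 : h ^ 2 <= Rabs h) by (rewrite <- pow2_abs; nra).
  assert (E3 : h ^ 2 * (l + 2 * (0 + M) ^ 2) <= Rabs h * (l + 2 * M ^ 2)).
  { replace (0 + M) with M by ring; apply Rmult_le_compat_r; [pose proof (pow2_ge_0 M); lra|assumption]. }
  assert (E4 : Rabs h * M * (2 + D) <= Rabs h * (M * (2 + R0))).
  { rewrite Rmult_assoc; apply Rmult_le_compat_l; [assumption|]; apply Rmult_le_compat_l; lra. }
  lra.
Qed.

(** * Efficient points of compact sets *)

Lemma vclosure_closed p (S : Vec p -> Prop) : vclosed_set (vclosure S).
Proof.
  intros y l Hy Hl e He; rewrite vcv_iff in Hl; destruct (Hl (e / 2) ltac:(lra)) as [N HN].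
  destruct (Hy N (e / 2) ltac:(lra)) as (z & Hz & Hd); exists z; split; [assumption|].
  specialize (HN N (le_n N)); pose proof (norm_sub_triang _ (y N) z l); lra.
Qed.

Lemma vclosure_bounded p (S : Vec p -> Prop) M :
  (forall y, S y -> norm y <= M) -> forall y, vclosure S y -> norm y <= M.
Proof.
  intros H y Hy; apply Rnot_lt_le; intros C.
  destruct (Hy (norm y - M)) as (z & Hz & Hd); [lra|]; specialize (H z Hz).
  rewrite norm_sub_sym in Hd; pose proof (norm_le_sub _ y z); lra.
Qed.

(* Each step of the descent covers at least half of what remains below, so that the limit is
   minimal; the order limit is unique because [P] is pointed. *)
Lemma efficient_below p (S P : Vec p -> Prop) M y0 :
  vclosed_set S -> (forall y, S y -> norm y <= M) ->
  vclosed_set P -> vconvex_set P -> is_cone P -> pointed P -> P vzero -> S y0 ->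
  exists v, efficient S P v /\ P (vsub y0 v).
Proof.
  intros HS HM HPc HPv HPn HPp HP0 Hy0.
  assert (Hself : forall y : Vec p, P (vsub y y)).
  { intros y; replace (vsub y y) with (@vzero p) by vec_ext; assumption. }
  assert (Htrans : forall a b c : Vec p, P (vsub a b) -> P (vsub b c) -> P (vsub a c)).
  { intros a b c H H'; replace (vsub a c) with (vadd (vsub a b) (vsub b c)) by vec_ext.
    now apply cone_add. }
  assert (Hnext : forall y, exists z, S y -> S z /\ P (vsub y z) /\
    forall w, S w -> P (vsub y w) -> norm (vsub w y) <= 2 * norm (vsub z y)).
  { intros y; destruct (classic (S y)) as [Hy|Hy]; [|exists y; intros; contradiction].
    set (A := fun r => exists w, S w /\ P (vsub y w) /\ r = norm (vsub w y)).
    destruct (completeness A) as [s [Hub Hlub]].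
    { exists (M + M); intros r (w & Hw & _ & ->).
      replace (vsub w y) with (vadd w (vopp y)) by vec_ext.
      eapply Rle_trans; [apply norm_add|]; rewrite norm_opp.
      pose proof (HM w Hw); pose proof (HM y Hy); lra. }
    { exists (norm (vsub y y)), y; auto. }
    assert (Hub' : forall w, S w -> P (vsub y w) -> norm (vsub w y) <= s)
      by (intros w Hw Pw; apply Hub; exists w; auto).
    destruct (Rle_lt_dec s 0) as [Hs|Hs].
    - exists y; intros _; repeat split; auto; intros w Hw Pw; rewrite norm_sub_self.
      specialize (Hub' w Hw Pw); lra.
    - assert (Hw : exists w, S w /\ P (vsub y w) /\ s / 2 < norm (vsub w y)).
      { apply NNPP; intros C; assert (B : is_upper_bound A (s / 2)).
        { intros r (w & Hw & Pw & ->); apply Rnot_lt_le; intros D; apply C; now exists w. }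
        specialize (Hlub _ B); lra. }
      destruct Hw as (z & Hz & Pz & Hlt); exists z; intros _; repeat split; auto.
      intros w Hw Pw; specialize (Hub' w Hw Pw); lra. }
  apply functional_choice in Hnext; destruct Hnext as [g Hg].
  set (Y := fun k => Nat.iter k g y0).
  assert (HY : forall k, S (Y k)) by (intros k; induction k as [|k IH]; [assumption|now apply Hg]).
  assert (Hdec : forall j k, (j <= k)%nat -> P (vsub (Y j) (Y k))).
  { intros j k Hjk; induction Hjk as [|k Hk IH]; [apply Hself|].
    apply Htrans with (Y k); [assumption|now apply Hg]. }
  assert (Hlow : forall phi l, increasing_nat phi -> vcv (fun k => Y (phi k)) l ->
    forall k, P (vsub (Y k) l)).
  { intros phi l Hphi Hl k.
    apply HPc with (fun j => vsub (Y k) (Y (phi (k + j)%nat))).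
    - intros j; apply Hdec; pose proof (increasing_nat_ge phi Hphi (k + j)); lia.
    - apply vcv_sub; [apply vcv_const|].
      apply (vcv_subseq _ (fun k => Y (phi k)) l (fun j => (k + j)%nat)); [intros j; lia|assumption]. }
  (* The successors of the extracted terms are extracted again: once both limits agree, consecutive
     terms along [psi] become arbitrarily close. *)
  destruct (bolzano_weierstrass _ Y M) as (phi & l & Hphi & Hl); [auto|].
  destruct (bolzano_weierstrass _ (fun k => Y (Datatypes.S (phi k))) M) as (psi & l' & Hpsi & Hl'); [auto|].
  assert (Hphi' : increasing_nat (fun k => Datatypes.S (phi (psi k)))).
  { pose proof (increasing_nat_comp _ _ Hphi Hpsi) as H; intros k; specialize (H k); simpl in H; lia. }
  assert (Hll : vcv (fun k => Y (phi (psi k))) l)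
    by exact (vcv_subseq _ (fun k => Y (phi k)) l psi Hpsi Hl).
  assert (E : l = l').
  { assert (P1 : P (vsub l l')).
    { apply HPc with (fun k => vsub (Y (phi k)) l').
      - intros k; exact (Hlow _ l' Hphi' Hl' (phi k)).
      - apply vcv_sub; [assumption|apply vcv_const]. }
    assert (P2 : P (vsub l' l)).
    { apply HPc with (fun k => vsub (Y (Datatypes.S (phi (psi k)))) l).
      - intros k; exact (Hlow _ l Hphi Hl _).
      - apply vcv_sub; [assumption|apply vcv_const]. }
    assert (Z : vsub l l' = vzero).
    { apply HPp; [assumption|]; replace (vopp (vsub l l')) with (vsub l' l) by vec_ext; assumption. }
    apply norm_sub_eq; rewrite Z, norm_zero; lra. }
  subst l'; exists l; split; [|exact (Hlow _ l Hphi Hl O)].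
  assert (HSl : S l) by (apply HS with (fun k => Y (phi k)); auto).
  split; [assumption|]; intros w; split.
  (* A competitor [w] below [l] is below every term, hence at most twice as far from it as the next
     term is; so the terms converge to [w] too. *)
  - intros [(q & Pq & Ew) Sw].
    assert (Pw : P (vsub l w)) by (subst w; replace (vsub l (vsub l q)) with q by vec_ext; assumption).
    apply (vcv_unique _ (fun k => Y (phi (psi k)))); [|assumption].
    apply vcv_dominated with (fun k => 2 * norm (vsub (Y (Datatypes.S (phi (psi k)))) (Y (phi (psi k))))).
    + intros k; rewrite norm_sub_sym; apply Hg; auto; apply Htrans with l; [|assumption].
      exact (Hlow _ l Hphi Hl _).
    + replace 0 with (2 * 0) by ring; apply CV_mult.
      * intros e He; exists O; intros; unfold Rdist; rewrite Rminus_diag, Rabs_R0; assumption.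
      * pose proof (vcv_sub _ _ _ _ _ Hl' Hll) as Hd.
        replace (vsub l l) with (@vzero p) in Hd by vec_ext.
        unfold vcv in Hd; eapply Un_cv_ext; [|exact Hd]; intros k; simpl; f_equal; vec_ext.
  - intros ->; split; [|assumption]; exists vzero; split; [assumption|vec_ext].
Qed.

Lemma Un_cv_inv_INR : Un_cv (fun k => / (INR k + 1)) 0.
Proof.
  intros e He; destruct (archimed_cor1 e He) as [N [HN HN0]]; exists N; intros k Hk.
  pose proof (pos_INR k); assert (0 < / (INR k + 1)) by (apply Rinv_0_lt_compat; lra).
  unfold Rdist; rewrite Rminus_0_r, Rabs_pos_eq by lra.
  eapply Rle_lt_trans; [|exact HN]; apply Rinv_le_contravar; [now apply lt_0_INR|].
  apply le_INR in Hk; lra.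
Qed.

(** * Gluing of curves at a switching time *)

Lemma lipschitz_switch n a b c (g g' : R -> Vec n) M : lipschitz_on a b g M ->
  lipschitz_on b c g' M -> g b = g' b -> lipschitz_on a c (switch b g g') M.
Proof.
  intros H H' E r s Hr Hrs Hs; destruct (Rlt_le_dec s b) as [D|D].
  - rewrite !switch_lt by lra; apply H; lra.
  - rewrite (switch_ge _ _ _ _ s) by lra; destruct (Rlt_le_dec r b) as [D'|D'].
    + rewrite switch_lt by lra; specialize (H r b Hr ltac:(lra) ltac:(lra)).
      specialize (H' b s ltac:(lra) D Hs); rewrite <- E in H'.
      pose proof (norm_sub_triang _ (g b) (g' s) (g r)); lra.
    + rewrite switch_ge by lra; apply H'; lra.
Qed.

(** At the switching time the one-sided derivatives may differ; this single point is put into the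
    null set. Elsewhere the glued curve agrees locally with one of its parts. *)
Lemma ae_switch n a b c (g g' d d' d'' : R -> Vec n) :
  ae_on a b (fun s => has_vderiv g s (d s)) ->
  (forall s, b < s <= c -> has_vderiv g' s (d' s)) ->
  (forall s, s < b -> d'' s = d s) -> (forall s, b < s -> d'' s = d' s) ->
  ae_on a c (fun s => has_vderiv (switch b g g') s (d'' s)).
Proof.
  intros H H' E E'.
  apply null_set_subset with (fun s => (a <= s <= b /\ ~ has_vderiv g s (d s)) \/ s = b);
    [|apply null_set_union; [assumption|apply null_set_point]].
  intros s [Hs N]; destruct (Rtotal_order s b) as [D|[D|D]]; [left|right; assumption|].
  - split; [lra|]; intros Hd; apply N; rewrite E by assumption.
    apply has_vderiv_ext_loc with g (b - s); [lra| |assumption].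
    intros r Hr; apply switch_lt; apply Rabs_def2 in Hr; lra.
  - exfalso; apply N; rewrite E' by assumption.
    apply has_vderiv_ext_loc with g' (s - b); [lra| |apply H'; lra].
    intros r Hr; apply switch_ge; apply Rabs_def2 in Hr; lra.
Qed.

(** * Invariance of the graph of the upper set *)

Section Viability.

Variables (T : R) (n m p : nat) (U : Vec m -> Prop).
Variables (f : Vec n -> Vec m -> Vec n) (L : Vec n -> Vec m -> Vec p).
Variables (Kf Mf KL ML : R) (P : Vec p -> Prop) (W : R -> Vec n -> Vec p -> Prop).
Hypothesis (hfL : forall x1 x2 u, U u -> norm (vsub (f x1 u) (f x2 u)) <= Kf * norm (vsub x1 x2)).
Hypothesis (hfB : forall x u, U u -> norm (f x u) <= Mf).
Hypothesis (hLB : forall x u, U u -> norm (L x u) <= ML).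
Hypothesis (hLL : forall x1 x2 u, U u -> norm (vsub (L x1 u) (L x2 u)) <= KL * norm (vsub x1 x2)).
Hypothesis (hKf : 0 < Kf).
Hypotheses (hPcv : vconvex_set P) (hPcone : is_cone P) (hP0 : P vzero).
Hypothesis (h1 : osc_on T (upset W P)).
Hypothesis (h2 : forall t x y ws, 0 < t < T -> W t x y ->
  (exists xis vs, coderiv T (upset W P) t x y ws xis vs) ->
  forall xis vs, coderiv T (upset W P) t x y ws xis vs ->
    exists a b, FL U f L x a b /\
      (forall a' b', FL U f L x a' b' -> inner vs a + inner ws b <= inner vs a' + inner ws b') /\
      xis + (inner vs a + inner ws b) = 0).

Hypothesis (h3 : forall x y,
  (upset W P 0 x y -> limsup_within (fun t => 0 < t <= T) (upset W P) 0 x y) /\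
  (upset W P T x y -> limsup_within (fun t => 0 <= t < T) (upset W P) T x y)).
Hypothesis (h4 : forall x y, W T x y <-> y = vzero).

Let gr := graph T (upset W P).
(** Growth rate of the pairing of a normal with the velocities, relative to the squared distance.
    The absolute value is there because [KL] carries no sign hypothesis. *)
Let K := Kf + Rabs KL.

(* A normal at [w + q] with [q] in [P] is also normal at [w], since the graph is stable under
   adding [q]. *)
Lemma closest_normal l t x y tz xz yz : 1 <= l -> closest T (upset W P) l t x y tz xz yz ->
  exists w, W tz xz w /\
    prox_normal T (upset W P) tz xz w (l * (t - tz)) (vsub x xz) (vsub y yz).
Proof.
  intros Hl [[Htz (w & q & HW & HP & ->)] Hmin].
  exists w; split; [assumption|]; split.
  { split; [assumption|]; exists w, vzero; repeat split; try assumption; vec_ext. }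
  (* The weight is the proximal constant: expanding the minimality leaves [l * h ^ 2 + X + Y], at
     most [l] times the squared Euclidean distance since [1 <= l]. *)
  exists l; split; [lra|]; intros t' x' y' [Ht' (w' & q' & HW' & HP' & ->)].
  specialize (Hmin t' x' (vadd (vadd w' q') q)).
  assert (G : graph T (upset W P) t' x' (vadd (vadd w' q') q)).
  { split; [assumption|]; exists w', (vadd q' q); repeat split; try assumption.
    - now apply cone_add.
    - vec_ext. }
  specialize (Hmin G); unfold wdist in Hmin.
  set (y' := vadd w' q') in *; set (v := vsub x xz) in *; set (r := vsub y (vadd w q)) in *.
  replace (vsub x x') with (vsub v (vsub x' xz)) in Hmin by (unfold v; vec_ext).
  replace (vsub y (vadd y' q)) with (vsub r (vsub y' w)) in Hmin by (unfold r; vec_ext).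
  set (dx := vsub x' xz) in *; set (dy := vsub y' w) in *.
  rewrite (inner_sub_l _ v dx), (inner_sub_l _ r dy), !inner_sub_r in Hmin.
  rewrite (inner_sym _ dx v), (inner_sym _ dy r) in Hmin.
  pose proof (inner_nonneg _ dx); pose proof (inner_nonneg _ dy).
  pose proof (pow2_ge_0 (t' - tz)).
  replace (t - t') with ((t - tz) - (t' - tz)) in Hmin by ring.
  set (h := t' - tz) in *; set (X := inner dx dx) in *; set (Y := inner dy dy) in *.
  assert (2 * (l * (t - tz) * h + inner v dx + inner r dy) <= l * h ^ 2 + X + Y)
    by (clearbody X Y; clear - Hmin; nra).
  assert (X <= l * X) by nra; assert (Y <= l * Y) by nra; nra.
Qed.

Lemma FL_point x u : U u -> FL U f L x (f x u) (L x u).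
Proof.
  intros Hu e He; exists (f x u), (L x u); rewrite !norm_sub_self; repeat split; try assumption.
  exists ((1, u) :: nil); simpl; repeat split; [|ring|vec_ext|vec_ext].
  apply Forall_cons; [simpl; split; [lra|assumption]|apply Forall_nil].
Qed.

(** The coderivative flips the cost component, so (2) is used with [ws = - (y - yz)]. Its minimum
    runs over the closed convex hull; an average cannot lie below all of its terms, so up to [e] the
    minimum is reached at a point of [U]. *)
Lemma closest_velocity l t x y tz xz yz : 1 <= l -> 0 < tz < T ->
  closest T (upset W P) l t x y tz xz yz ->
  (forall u, U u ->
     0 <= l * (t - tz) + inner (vsub x xz) (f xz u) - inner (vsub y yz) (L xz u)) /\
  (forall e, 0 < e -> exists u, U u /\
     l * (t - tz) + inner (vsub x xz) (f xz u) - inner (vsub y yz) (L xz u) <= e).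
Proof.
  intros Hl Htz Hc; destruct (closest_normal _ _ _ _ _ _ _ Hl Hc) as (w & HW & HN).
  set (xs := l * (t - tz)) in *; set (v := vsub x xz) in *; set (r := vsub y yz) in *.
  assert (HD : coderiv T (upset W P) tz xz w (vopp r) xs v).
  { unfold coderiv; replace (vopp (vopp r)) with r by vec_ext; assumption. }
  destruct (h2 tz xz w (vopp r) Htz HW ltac:(eauto) xs v HD) as (a & b & Hab & Hmin & Heq).
  split.
  - intros u Hu; specialize (Hmin _ _ (FL_point xz u Hu)); rewrite !inner_opp_l in *; lra.
  - intros e He; apply NNPP; intros C.
    assert (HC : forall u, U u -> - xs + e <= inner v (f xz u) - inner r (L xz u)).
    { intros u Hu; apply Rnot_lt_le; intros D; apply C; exists u; split; [assumption|lra]. }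
    (* With this [N], moving both components by less than [e / N] changes the pairing by less than
       [e]. *)
    set (N := norm v + norm r + 1).
    assert (HN0 : 0 < N) by (unfold N; pose proof (norm_nonneg _ v); pose proof (norm_nonneg _ r); lra).
    destruct (Hab (e / N)) as (a' & b' & (lu & Hlu & Hsum & Ha' & Hb') & Na & Nb);
      [now apply Rdiv_lt_0_compat|].
    assert (Hco : - xs + e <= inner v a' - inner r b').
    { replace (- xs + e) with ((- xs + e) * 1) by ring; rewrite <- Hsum; subst a' b'.
      clear - Hlu HC; induction lu as [|[lam u] lu IH]; simpl.
      - rewrite !inner_zero_r; lra.
      - inversion_clear Hlu; specialize (IH H0); simpl in H; destruct H as [H H'].
        specialize (HC u H'); rewrite !inner_add_r, !inner_scal_r; nra. }
    rewrite inner_opp_l in Heq.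
    pose proof (cauchy_schwarz _ v (vsub a' a)) as C1; apply Rabs_le_between in C1.
    pose proof (cauchy_schwarz _ r (vsub b' b)) as C2; apply Rabs_le_between in C2.
    rewrite inner_sub_r in C1, C2.
    pose proof (norm_nonneg _ v); pose proof (norm_nonneg _ r).
    assert (D1 : norm v * norm (vsub a' a) <= norm v * (e / N)) by (apply Rmult_le_compat_l; lra).
    assert (D2 : norm r * norm (vsub b' b) <= norm r * (e / N)) by (apply Rmult_le_compat_l; lra).
    assert (He' : 0 < e / N) by (now apply Rdiv_lt_0_compat).
    assert (D3 : N * (e / N) = e) by (field; lra).
    unfold N in D3 at 1; lra.
Qed.

(** Replacing the velocity at [xz] by the one at [x] costs [norm (x - xz)] times a constant, paired
    with a vector whose length is again controlled by the distance. The product is quadratic, hence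
    of the order of [wdist] itself. *)
Lemma Lipschitz_drift l t x y tz xz yz u : 1 <= l -> U u ->
  Rabs (inner (vsub x xz) (f x u) - inner (vsub y yz) (L x u)
    - (inner (vsub x xz) (f xz u) - inner (vsub y yz) (L xz u))) <= K * wdist l t x y tz xz yz.
Proof.
  intros Hl Hu.
  destruct (wdist_bounds _ _ l t x y tz xz yz Hl) as (_ & _ & B1 & _ & B2).
  set (D := wdist l t x y tz xz yz) in *.
  replace (_ - _) with (inner (vsub x xz) (vsub (f x u) (f xz u))
    - inner (vsub y yz) (vsub (L x u) (L xz u))) by (rewrite !inner_sub_r; ring).
  pose proof (cauchy_schwarz _ (vsub x xz) (vsub (f x u) (f xz u))) as C1.
  pose proof (cauchy_schwarz _ (vsub y yz) (vsub (L x u) (L xz u))) as C2.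
  specialize (hfL x xz u Hu) as F1; specialize (hLL x xz u Hu) as F2.
  set (X := norm (vsub x xz)) in *; set (Y := norm (vsub y yz)) in *.
  assert (HX : 0 <= X) by apply norm_nonneg; assert (HY : 0 <= Y) by apply norm_nonneg.
  assert (E1 : X * norm (vsub (f x u) (f xz u)) <= Kf * D).
  { apply Rle_trans with (X * (Kf * X)); [now apply Rmult_le_compat_l|]; nra. }
  assert (E2 : Y * norm (vsub (L x u) (L xz u)) <= Rabs KL * D).
  { apply Rle_trans with (Y * (Rabs KL * X)).
    - apply Rmult_le_compat_l; [assumption|]; eapply Rle_trans; [exact F2|].
      apply Rmult_le_compat_r; [assumption|apply Rle_abs].
    - pose proof (Rabs_pos KL).
      assert (Y * X <= D) by nra; nra. }
  unfold K; eapply Rle_trans; [apply Rabs_triang|]; rewrite Rabs_Ropp; lra.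
Qed.

Lemma closest_time_interior l t (x : Vec n) (y : Vec p) tz xz yz R0 mu : 1 <= l -> 0 < mu ->
  wdist l t x y tz xz yz <= R0 -> R0 < l * mu ^ 2 -> mu <= t -> t <= T - mu -> 0 < tz < T.
Proof.
  intros Hl Hmu HR Hlm H0 HT.
  destruct (wdist_bounds _ _ l t x y tz xz yz Hl) as (_ & B & _).
  assert (B' : (t - tz) ^ 2 < mu ^ 2) by nra; split; nra.
Qed.

(* Large [l] forces the closest point to have its time in the open interval, without
   affecting the growth rate [K] since the dynamics are autonomous. *)
Lemma backward_invariance t0 b (xi : R -> Vec n) (c : R -> Vec p) u y xb yb e :
  0 < t0 -> t0 <= b -> b < T ->
  lipschitz_on t0 b xi Mf -> lipschitz_on t0 b c ML ->
  ae_on t0 b (fun s => has_vderiv xi s (f (xi s) (u s))) ->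
  ae_on t0 b (fun s => has_vderiv c s (L (xi s) (u s))) ->
  (forall s, t0 <= s <= b -> U (u s)) ->
  gr b xb yb -> 0 < e -> wdist 1 b (xi b) (vsub y (c b)) b xb yb <= e ->
  exists tz xz yz, gr tz xz yz /\
    wdist 1 t0 (xi t0) (vsub y (c t0)) tz xz yz <= 2 * e * exp (2 * K * T).
Proof.
  intros Ht0 Hb0 HbT Lxi Lc Dxi Dc Hu Hgb He Heb.
  assert (HK : 0 <= K) by (unfold K; pose proof (Rabs_pos KL); lra).
  set (A := 2 * K); assert (HA : 0 <= A) by (unfold A; lra).
  (* A priori bound for the squared distance: one [e] for the initial value, one for the accumulated
     errors. It does not involve [l], so [l] may be chosen from it. *)
  set (R0 := 2 * e * exp (A * T)).
  assert (Hexp1 : forall s, 0 <= s -> 1 <= exp (A * s)).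
  { intros s Hs; pose proof (exp_ineq1_le (A * s)); nra. }
  assert (Hexpm : forall r s, r <= s -> exp (A * r) <= exp (A * s)).
  { intros r s Hrs; apply exp_monotone; nra. }
  assert (HR0 : 0 < R0) by (unfold R0; specialize (Hexp1 T ltac:(lra)); nra).
  set (mu := Rmin t0 (T - b)).
  assert (Hmu : 0 < mu) by (apply Rmin_pos; lra).
  pose proof (Rmin_l t0 (T - b)) as Hmu1; pose proof (Rmin_r t0 (T - b)) as Hmu2; fold mu in Hmu1, Hmu2.
  set (l := 1 + R0 / mu ^ 2).
  assert (Hmusq : 0 < mu ^ 2) by (apply pow_lt; assumption).
  assert (Hl : 1 <= l).
  { unfold l; assert (0 < R0 / mu ^ 2) by (now apply Rdiv_lt_0_compat); lra. }
  assert (Hlmu : R0 < l * mu ^ 2).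
  { unfold l; replace ((1 + R0 / mu ^ 2) * mu ^ 2) with (mu ^ 2 + R0) by (field; lra); lra. }
  pose (d := fun s tz xz yz => wdist l s (xi s) (vsub y (c s)) tz xz yz).
  assert (Hd0 : forall s tz xz yz, 0 <= d s tz xz yz) by (intros; now apply wdist_nonneg).
  set (M := Rabs Mf + Rabs ML).
  assert (HM : 0 <= M) by (unfold M; pose proof (Rabs_pos Mf); pose proof (Rabs_pos ML); lra).
  set (Lam0 := 2 * l + R0 + M * (2 + R0) + 2 * M ^ 2).
  assert (HLam0 : 0 <= Lam0) by (unfold Lam0; pose proof (pow2_ge_0 M); nra).
  set (Lam := Lam0 * exp (A * T) + 1).
  assert (HLam : 0 < Lam) by (unfold Lam; specialize (Hexp1 T ltac:(lra)); nra).
  assert (Hincy : forall s h, vsub y (c (s + - h)) = vadd (vsub y (c s)) (vsub (c s) (c (s + - h))))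
    by (intros; vec_ext).
  assert (Hincx : forall s h, xi (s + - h) = vadd (xi s) (vsub (xi (s + - h)) (xi s)))
    by (intros; vec_ext).
  assert (coarse : forall s h tz xz yz, t0 <= s - h -> s <= b -> 0 <= h <= 1 -> d s tz xz yz <= R0 ->
    d (s - h) tz xz yz * exp (A * (s - h)) <= d s tz xz yz * exp (A * s) + h * Lam).
  { intros s h tz xz yz H1 H2 H3 H4.
    assert (St : d (s - h) tz xz yz <= d s tz xz yz + h * Lam0).
    { unfold d, Rminus; rewrite (Hincx s h), (Hincy s h).
      rewrite <- (Rabs_pos_eq h) at 4 by lra; rewrite <- (Rabs_Ropp h).
      specialize (Lxi (s - h) s H1 ltac:(lra) H2); specialize (Lc (s - h) s H1 ltac:(lra) H2).
      rewrite norm_sub_sym in Lxi; unfold Rminus in Lxi, Lc.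
      pose proof (Rle_abs Mf); pose proof (Rle_abs ML); pose proof (Rabs_pos Mf); pose proof (Rabs_pos ML).
      apply wdist_coarse; try assumption; rewrite Rabs_Ropp, (Rabs_pos_eq h) by lra;
        unfold M; [lra|nra|nra]. }
    pose proof (Hexpm (s - h) s ltac:(lra)); pose proof (Hexpm s T ltac:(lra)).
    pose proof (Hexp1 (s - h) ltac:(lra)); pose proof (Hd0 s tz xz yz).
    apply Rle_trans with ((d s tz xz yz + h * Lam0) * exp (A * s)).
    - apply Rmult_le_compat; [apply Hd0|lra|assumption|assumption].
    - assert (0 <= h * Lam0) by nra; unfold Lam; nra. }
  (* Error allowed per unit of time at points of differentiability; over [[t0, b]] it amounts to at
     most [e / 2]. The gauge of the exceptional times, scaled by [Lam], uses the other half. *)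
  set (kap := e / (2 * (T + 1))).
  assert (Hkap : 0 < kap) by (apply Rdiv_lt_0_compat; lra).
  set (E := fun s => (t0 <= s <= b) /\ ~ (has_vderiv xi s (f (xi s) (u s)) /\
    has_vderiv c s (L (xi s) (u s)))).
  assert (HE : null_set E).
  { apply null_set_subset with (fun s => (t0 <= s <= b /\ ~ has_vderiv xi s (f (xi s) (u s))) \/
      (t0 <= s <= b /\ ~ has_vderiv c s (L (xi s) (u s)))).
    - intros s [H1 H2]; apply not_and_or in H2; tauto.
    - now apply null_set_union. }
  destruct (null_set_gauge E (e / (2 * Lam)) HE) as (g & Hgm & Hgr & Hgb');
    [apply Rdiv_lt_0_compat; lra|].
  set (rhs := fun s => e * exp (A * b) + kap * (b - s) + Lam * (g b - g s)).
  assert (Hrhs : forall s, t0 <= s <= b -> rhs s <= R0).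
  { intros s Hs; unfold rhs, R0.
    assert (kap * (b - s) <= e / 2).
    { apply Rle_trans with (kap * (T + 1)); [apply Rmult_le_compat_l; lra|].
      unfold kap; right; field; lra. }
    assert (Lam * (g b - g s) <= e / 2).
    { apply Rle_trans with (Lam * (e / (2 * Lam))).
      - apply Rmult_le_compat_l; [lra|]; pose proof (Hgr b); pose proof (Hgr s); lra.
      - right; field; lra. }
    pose proof (Hexpm b T ltac:(lra)); pose proof (Hexp1 T ltac:(lra)); nra. }
  assert (Hrhsm : forall r s, r <= s -> rhs s <= rhs r).
  { intros r s Hrs; unfold rhs; specialize (Hgm r s Hrs); nra. }
  (* The bound asks for some point of the graph, not for the closest one, so a frozen point can
     witness it at the neighbouring times. *)
  set (S := fun s => exists tz xz yz, gr tz xz yz /\ d s tz xz yz * exp (A * s) <= rhs s).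
  assert (HSR : forall s tz xz yz, t0 <= s <= b -> d s tz xz yz * exp (A * s) <= rhs s ->
    d s tz xz yz <= R0).
  { intros s tz xz yz Hs H; specialize (Hrhs s Hs); specialize (Hexp1 s ltac:(lra)).
    specialize (Hd0 s tz xz yz); nra. }
  assert (HSc : forall s r, S r -> exists tz xz yz,
      closest T (upset W P) l s (xi s) (vsub y (c s)) tz xz yz).
  { intros s r (t' & x' & y' & G & _); now apply closest_exists with t' x' y'. }
  assert (HS : S t0).
  { apply leftward_induction with b; [assumption| | |].
    - exists b, xb, yb; split; [assumption|].
      (* The initial graph point has the same time as the curve, so the weight [l] does not enlarge
         its distance. *)
      replace (d b b xb yb) with (wdist 1 b (xi b) (vsub y (c b)) b xb yb)
        by (unfold d, wdist; ring).
      unfold rhs; pose proof (exp_pos (A * b)); nra.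
    - intros s Hs Hr.
      destruct (HSc s b (Hr b ltac:(lra))) as (tz & xz & yz & G & Hmin).
      exists tz, xz, yz; split; [assumption|]; apply Rnot_lt_le; intros C.
      set (gap := d s tz xz yz * exp (A * s) - rhs s).
      (* For this [h] the coarse growth from [s + h] back to [s] is at most half of the supposed
         excess. *)
      set (h := Rmin 1 (Rmin (b - s) (gap / (2 * Lam)))).
      assert (Hgap : 0 < gap) by (unfold gap; lra).
      assert (Hh : 0 < h /\ h <= 1 /\ h <= b - s /\ h <= gap / (2 * Lam)).
      { assert (0 < gap / (2 * Lam)) by (apply Rdiv_lt_0_compat; lra).
        unfold h, Rmin; repeat destruct Rle_dec; lra. }
      destruct (Hr (s + h) ltac:(lra)) as (t' & x' & y' & G' & Hd).
      pose proof (coarse (s + h) h t' x' y' ltac:(lra) ltac:(lra) ltac:(lra)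
        (HSR (s + h) t' x' y' ltac:(lra) Hd)) as Co.
      replace (s + h - h) with s in Co by ring.
      specialize (Hmin t' x' y' G'); fold (d s tz xz yz) (d s t' x' y') in Hmin.
      specialize (Hrhsm s (s + h) ltac:(lra)).
      assert (h * Lam <= gap / 2).
      { apply Rle_trans with (gap / (2 * Lam) * Lam); [apply Rmult_le_compat_r; lra|].
        right; field; lra. }
      pose proof (exp_pos (A * s)); unfold gap in *; nra.
    - intros s Hs HSs.
      destruct (HSc s s HSs) as (tz & xz & yz & Hcl); destruct HSs as (t' & x' & y' & G' & Hd').
      assert (Hd : d s tz xz yz * exp (A * s) <= rhs s).
      { eapply Rle_trans; [|exact Hd']; apply Rmult_le_compat_r; [left; apply exp_pos|].
        now apply Hcl. }
      pose proof (HSR s tz xz yz ltac:(lra) Hd) as HR.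
      destruct (classic (E s)) as [Hbad|Hgood].
      + destruct (Hgb' s Hbad) as (h & Hh & Hg); exists (Rmin h 1).
        split; [apply Rmin_pos; lra|]; intros r Hr Hr'; exists tz, xz, yz; split; [apply Hcl|].
        pose proof (Rmin_l h 1); pose proof (Rmin_r h 1).
        pose proof (coarse s (s - r) tz xz yz ltac:(lra) ltac:(lra) ltac:(lra) HR) as Co.
        replace (s - (s - r)) with r in Co by ring.
        specialize (Hg r s ltac:(lra) ltac:(lra) ltac:(lra)); unfold rhs in *; nra.
      + assert (Hder : has_vderiv xi s (f (xi s) (u s)) /\ has_vderiv c s (L (xi s) (u s))).
        { apply NNPP; intros C; apply Hgood; split; [lra|assumption]. }
        destruct Hder as [Hdx Hdc].
        assert (Hus : U (u s)) by (apply Hu; lra).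
        assert (Htz : 0 < tz < T).
        { apply (closest_time_interior l s (xi s) (vsub y (c s)) tz xz yz R0 mu); try assumption; lra. }
        (* The step is [- h], so a nonnegative pairing with the velocity under [u s] makes the
           first-order term nonpositive up to the drift. *)
        destruct (closest_velocity _ _ _ _ _ _ _ Hl Htz Hcl) as [Hv _]; specialize (Hv _ Hus).
        pose proof (Lipschitz_drift l s (xi s) (vsub y (c s)) tz xz yz (u s) Hl Hus) as Hdr.
        fold (d s tz xz yz) in Hdr; apply Rabs_le_between in Hdr.
        set (ET := exp (A * T)).
        assert (HET : 1 <= ET) by (apply Hexp1; lra).
        set (e1 := kap / (2 * (2 + R0) * ET)).
        assert (He1 : 0 < e1) by (apply Rdiv_lt_0_compat; nra).
        destruct (has_vderiv_expand _ _ _ _ e1 Hdx He1) as (h1' & Hh1 & Ex1).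
        destruct (has_vderiv_expand _ _ _ _ e1 Hdc He1) as (h2' & Hh2 & Ex2).
        set (C0 := l + 2 * (M + e1) ^ 2).
        assert (HC0 : 1 <= C0) by (unfold C0; pose proof (pow2_ge_0 (M + e1)); lra).
        set (h0 := Rmin (Rmin h1' h2') (kap / (2 * C0 * ET))).
        assert (Hh0' : 0 < kap / (2 * C0 * ET)) by (apply Rdiv_lt_0_compat; nra).
        exists h0; split; [repeat apply Rmin_pos; assumption|].
        intros r Hr Hr'; exists tz, xz, yz; split; [apply Hcl|].
        set (h := s - r).
        assert (Hh : 0 < h /\ h < h1' /\ h < h2' /\ h < kap / (2 * C0 * ET)).
        { unfold h, h0, Rmin in *; repeat destruct Rle_dec; lra. }
        specialize (Ex1 (- h)); specialize (Ex2 (- h)); rewrite Rabs_Ropp, Rabs_pos_eq in Ex1, Ex2 by lra.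
        specialize (Ex1 ltac:(lra)); specialize (Ex2 ltac:(lra)).
        assert (Hf : norm (f (xi s) (u s)) <= M).
        { eapply Rle_trans; [now apply hfB|]; unfold M; pose proof (Rle_abs Mf); pose proof (Rabs_pos ML); lra. }
        assert (HL : norm (vopp (L (xi s) (u s))) <= M).
        { rewrite norm_opp; eapply Rle_trans; [now apply hLB|]; unfold M.
          pose proof (Rle_abs ML); pose proof (Rabs_pos Mf); lra. }
        pose proof (wdist_step _ _ l s (xi s) (vsub y (c s)) tz xz yz (- h)
          (vsub (xi (s + - h)) (xi s)) (vsub (c s) (c (s + - h)))
          (f (xi s) (u s)) (vopp (L (xi s) (u s))) e1 M Hl ltac:(lra) Hf HL) as St.
        rewrite Rabs_Ropp, (Rabs_pos_eq h) in St by lra.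
        specialize (St Ex1).
        assert (Ex2' : norm (vsub (vsub (c s) (c (s + - h))) (vscal (- h) (vopp (L (xi s) (u s))))) <= e1 * h).
        { rewrite <- norm_opp; eapply Rle_trans; [|exact Ex2]; right; f_equal; vec_ext. }
        specialize (St Ex2'); rewrite <- Hincx, <- Hincy, inner_opp_r in St.
        replace (s + - h) with r in St by (unfold h; ring).
        fold (d r tz xz yz) (d s tz xz yz) C0 in St.
        set (D := d s tz xz yz) in *.
        assert (St' : d r tz xz yz <= D * (1 + A * h) + h * (e1 * (2 + R0)) + h * (h * C0)).
        { replace ((- h) ^ 2 * (l + 2 * (M + e1) ^ 2)) with (h * (h * C0)) in St by (unfold C0; ring).
          assert (h * e1 * (2 + D) <= h * (e1 * (2 + R0))) by (rewrite Rmult_assoc; apply Rmult_le_compat_l; nra).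
          unfold A; nra. }
        assert (Q1 : e1 * (2 + R0) * ET = kap / 2) by (unfold e1; field; lra).
        assert (Q2 : h * C0 * ET <= kap / 2).
        { apply Rle_trans with (kap / (2 * C0 * ET) * C0 * ET); [|right; field; lra].
          apply Rmult_le_compat_r; [lra|]; apply Rmult_le_compat_r; lra. }
        assert (Her : 0 < exp (A * r) <= ET) by (split; [apply exp_pos|apply Hexpm; lra]).
        (* The exponential factor, smaller at the earlier time [r], compensates the growth by
           [1 + A * h]. *)
        assert (Hes : (1 + A * h) * exp (A * r) <= exp (A * s)).
        { replace (A * s) with (A * h + A * r) by (unfold h; ring); rewrite exp_plus.
          apply Rmult_le_compat_r; [lra|apply exp_ineq1_le]. }
        assert (HD : 0 <= D) by apply Hd0.
        assert (V : d r tz xz yz * exp (A * r) <= D * exp (A * s) + h * kap).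
        { apply Rle_trans with ((D * (1 + A * h) + h * (e1 * (2 + R0)) + h * (h * C0)) * exp (A * r));
            [apply Rmult_le_compat_r; lra|].
          assert (D * ((1 + A * h) * exp (A * r)) <= D * exp (A * s)) by (now apply Rmult_le_compat_l).
          assert (e1 * (2 + R0) * exp (A * r) <= e1 * (2 + R0) * ET) by (apply Rmult_le_compat_l; [apply Rmult_le_pos; lra|lra]).
          assert (h * C0 * exp (A * r) <= h * C0 * ET)
            by (apply Rmult_le_compat_l; [apply Rmult_le_pos; lra|lra]).
          assert (h * (e1 * (2 + R0) * exp (A * r) + h * C0 * exp (A * r)) <= h * kap)
            by (apply Rmult_le_compat_l; lra).
          lra. }
        assert (rhs s + h * kap <= rhs r); [|lra].
        unfold rhs, h; specialize (Hgm r s ltac:(lra)).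
        assert (Lam * g r <= Lam * g s) by (apply Rmult_le_compat_l; lra); lra. }
  destruct HS as (tz & xz & yz & G & Hd); exists tz, xz, yz; split; [assumption|].
  fold R0; eapply Rle_trans; [|exact (HSR t0 tz xz yz ltac:(lra) Hd)].
  unfold d, wdist; pose proof (pow2_ge_0 (t0 - tz)); nra.
Qed.

(** * Attainable costs belong to the upper set *)

Lemma graph_closed t x y : 0 <= t <= T ->
  (forall e, 0 < e -> exists tz xz yz, gr tz xz yz /\ Rabs (tz - t) <= e /\
     norm (vsub xz x) <= e /\ norm (vsub yz y) <= e) -> gr t x y.
Proof.
  intros Ht H; split; [assumption|]; apply h1; [assumption|].
  assert (Hk : forall k : nat, exists z : R * Vec n * Vec p,
    gr (fst (fst z)) (snd (fst z)) (snd z) /\ Rabs (fst (fst z) - t) <= / (INR k + 1) /\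
    norm (vsub (snd (fst z)) x) <= / (INR k + 1) /\ norm (vsub (snd z) y) <= / (INR k + 1)).
  { intros k; destruct (H (/ (INR k + 1))) as (tz & xz & yz & Hz); [|now exists (tz, xz, yz)].
    apply Rinv_0_lt_compat; pose proof (pos_INR k); lra. }
  apply functional_choice in Hk; destruct Hk as [z Hz].
  exists (fun k => fst (fst (z k))), (fun k => snd (fst (z k))), (fun k => snd (z k)); repeat split.
  - apply (Hz k).
  - apply (Hz k).
  - apply (Hz k).
  - intros e He; destruct (Un_cv_inv_INR e He) as [N HN]; exists N; intros k Hk.
    specialize (HN k Hk); unfold Rdist in *; rewrite Rminus_0_r in HN.
    eapply Rle_lt_trans; [apply (Hz k)|]; eapply Rle_lt_trans; [apply Rle_abs|exact HN].
  - apply vcv_dominated with (fun k => / (INR k + 1)); [intros; apply Hz|apply Un_cv_inv_INR].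
  - apply vcv_dominated with (fun k => / (INR k + 1)); [intros; apply Hz|apply Un_cv_inv_INR].
Qed.

Lemma wdist_small t (x : Vec n) (y : Vec p) tz xz yz e : 0 <= e ->
  wdist 1 t x y tz xz yz <= e ^ 2 ->
  Rabs (tz - t) <= e /\ norm (vsub xz x) <= e /\ norm (vsub yz y) <= e.
Proof.
  intros He H; destruct (wdist_bounds _ _ 1 t x y tz xz yz (Rle_refl 1)) as (B1 & _ & B2 & B3 & _).
  rewrite (norm_sub_sym _ xz), (norm_sub_sym _ yz).
  pose proof (norm_nonneg _ (vsub x xz)); pose proof (norm_nonneg _ (vsub y yz)).
  repeat split; [apply Rabs_le; split; nra|nra|nra].
Qed.

Lemma trajectory_bounds t x u xi c : 0 <= t <= T -> admissible T U u ->
  is_solution T f t x u xi -> abs_cont_on t T c ->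
  ae_on t T (fun s => has_vderiv c s (L (xi s) (u s))) ->
  lipschitz_on t T xi Mf /\ lipschitz_on t T c ML.
Proof.
  intros Ht (Hu & _) (_ & Hac & Hae) Hc Hc'; split.
  - apply abs_cont_lipschitz with (fun s => f (xi s) (u s)); try assumption.
    intros s Hs; apply hfB, Hu; lra.
  - apply abs_cont_lipschitz with (fun s => L (xi s) (u s)); try assumption.
    intros s Hs; apply hLB, Hu; lra.
Qed.

Lemma Yset_bounded t x y : 0 <= t <= T -> Yset T U f L t x y -> norm y <= Rabs ML * T.
Proof.
  intros Ht (u & xi & Hu & Hs & c & Hc0 & Hc & Hc' & ->).
  destruct (trajectory_bounds t x u xi c Ht Hu Hs Hc Hc') as [_ Lc].
  specialize (Lc t T ltac:(lra) ltac:(lra) ltac:(lra)); rewrite Hc0 in Lc.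
  replace (vsub (c T) vzero) with (c T) in Lc by vec_ext.
  pose proof (Rle_abs ML); pose proof (Rabs_pos ML); nra.
Qed.

(** The curve followed is [(s, xi s, c T - c s)], whose last component is the remaining cost.
    Backward invariance handles times strictly between [t] and [T]; the time [t], possibly [0], is
    then recovered from closedness of the graph. *)
Lemma Yset_subset_upset t x y : 0 <= t <= T -> Yset T U f L t x y -> upset W P t x y.
Proof.
  intros Ht (u & xi & Hu & Hs & c & Hc0 & Hc & Hc' & ->).
  destruct (trajectory_bounds t x u xi c Ht Hu Hs Hc Hc') as [Lx Lc].
  destruct (Rle_lt_or_eq_dec t T (proj2 Ht)) as [HtT|HtT].
  2:{ subst t; rewrite Hc0; exists vzero, vzero; repeat split; [now apply h4|assumption|vec_ext]. }
  set (M := Rabs Mf + Rabs ML).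
  assert (HM : 0 <= M) by (unfold M; pose proof (Rabs_pos Mf); pose proof (Rabs_pos ML); lra).
  assert (HMf : Mf <= M) by (unfold M; pose proof (Rle_abs Mf); pose proof (Rabs_pos ML); lra).
  assert (HML : ML <= M) by (unfold M; pose proof (Rle_abs ML); pose proof (Rabs_pos Mf); lra).
  assert (Hin : forall t0, t < t0 < T -> gr t0 (xi t0) (vsub (c T) (c t0))).
  { intros t0 Ht0; apply graph_closed; [lra|]; intros e He.
    set (X := exp (2 * K * T)); assert (HX : 0 < X) by apply exp_pos.
    (* Then [2 * e' * X = e ^ 2], which [wdist_small] turns into distances at most [e]. *)
    set (e' := e ^ 2 / (2 * X)).
    assert (He' : 0 < e') by (apply Rdiv_lt_0_compat; [apply pow_lt; lra|lra]).
    (* Two components of size [r] have squared distance at most [2 * r * r <= 2 * r <= e']. *)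
    set (r := Rmin 1 (e' / 2)).
    assert (Hr : 0 < r <= 1 /\ r <= e' / 2) by (unfold r, Rmin; destruct Rle_dec; lra).
    destruct (proj2 (h3 (xi T) vzero)) as (tk & xk & yk & Hk & Ck & Cx & Cy).
    { exists vzero, vzero; repeat split; [now apply h4|assumption|vec_ext]. }
    rewrite vcv_iff in Cx, Cy.
    destruct (Cx (r / 2) ltac:(lra)) as [N1 H1]; destruct (Cy (r / 2) ltac:(lra)) as [N2 H2].
    assert (Hd : 0 < Rmin (T - t0) (r / (2 * (M + 1)))).
    { apply Rmin_pos; [lra|apply Rdiv_lt_0_compat; lra]. }
    destruct (Ck _ Hd) as [N3 H3]; set (k := max N1 (max N2 N3)).
    specialize (H1 k ltac:(lia)); specialize (H2 k ltac:(lia)); specialize (H3 k ltac:(lia)).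
    destruct (Hk k) as [Htk Gk]; unfold Rdist in H3; rewrite Rabs_left in H3 by lra.
    pose proof (Rmin_l (T - t0) (r / (2 * (M + 1)))) as R1.
    pose proof (Rmin_r (T - t0) (r / (2 * (M + 1)))) as R2.
    assert (HMt : M * (T - tk k) <= r / 2).
    { apply Rle_trans with ((M + 1) * (r / (2 * (M + 1)))); [|right; field; lra].
      apply Rmult_le_compat; lra. }
    assert (B1 : norm (vsub (xi (tk k)) (xk k)) <= r).
    { specialize (Lx (tk k) T ltac:(lra) ltac:(lra) ltac:(lra)); rewrite norm_sub_sym in Lx.
      rewrite norm_sub_sym in H1; pose proof (norm_sub_triang _ (xi T) (xi (tk k)) (xk k)).
      assert (Mf * (T - tk k) <= M * (T - tk k)) by (apply Rmult_le_compat_r; lra); lra. }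
    assert (B2 : norm (vsub (vsub (c T) (c (tk k))) (yk k)) <= r).
    { specialize (Lc (tk k) T ltac:(lra) ltac:(lra) ltac:(lra)).
      replace (vsub (vsub (c T) (c (tk k))) (yk k)) with
        (vadd (vsub (c T) (c (tk k))) (vopp (vsub (yk k) vzero))) by vec_ext.
      eapply Rle_trans; [apply norm_add|]; rewrite norm_opp.
      assert (ML * (T - tk k) <= M * (T - tk k)) by (apply Rmult_le_compat_r; lra); lra. }
    destruct (backward_invariance t0 (tk k) xi c u (c T) (xk k) (yk k) e') as (tz & xz & yz & G & D);
      try assumption; try lra.
    - intros r0 s0 Hr0 Hrs Hs0; apply Lx; lra.
    - intros r0 s0 Hr0 Hrs Hs0; apply Lc; lra.
    - destruct Hs as (_ & _ & Hs); apply null_set_subset with (2 := Hs); simpl; intros s [Q Q']; split; [lra|assumption].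
    - apply null_set_subset with (2 := Hc'); simpl; intros s [Q Q']; split; [lra|assumption].
    - intros s Hs0; apply (proj1 Hu); lra.
    - split; [lra|assumption].
    - unfold wdist; rewrite <- !norm_sqr.
      pose proof (norm_nonneg _ (vsub (xi (tk k)) (xk k))).
      pose proof (norm_nonneg _ (vsub (vsub (c T) (c (tk k))) (yk k))); nra.
    - exists tz, xz, yz; split; [assumption|]; apply wdist_small; [lra|].
      fold X in D; replace (2 * e' * X) with (e ^ 2) in D by (unfold e'; field; lra); assumption. }
  apply (graph_closed t x (c T)); [assumption|]; intros e He.
  set (t0 := t + Rmin ((T - t) / 2) (e / (M + 1))).
  assert (Hd : 0 < e / (M + 1)) by (apply Rdiv_lt_0_compat; lra).
  assert (Ht0 : t < t0 < T /\ t0 - t <= e / (M + 1)) by (unfold t0, Rmin; destruct Rle_dec; lra).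
  assert (HMe : (M + 1) * (t0 - t) <= e).
  { apply Rle_trans with ((M + 1) * (e / (M + 1))); [|right; field; lra].
    apply Rmult_le_compat_l; lra. }
  exists t0, (xi t0), (vsub (c T) (c t0)); split; [apply Hin; lra|].
  specialize (Lx t t0 ltac:(lra) ltac:(lra) ltac:(lra)).
  specialize (Lc t t0 ltac:(lra) ltac:(lra) ltac:(lra)); rewrite Hc0 in Lc.
  destruct Hs as (Hx0 & _); rewrite Hx0 in Lx.
  assert (Mf * (t0 - t) <= M * (t0 - t)) by (apply Rmult_le_compat_r; lra).
  assert (ML * (t0 - t) <= M * (t0 - t)) by (apply Rmult_le_compat_r; lra).
  repeat split; [rewrite Rabs_pos_eq by lra; nra|lra|].
  replace (vsub (vsub (c T) (c t0)) (c T)) with (vopp (vsub (c t0) vzero)) by vec_ext.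
  rewrite norm_opp; lra.
Qed.

(** * Proximal aiming *)

(** The curves are controlled up to [tau], the control on the whole horizon. Lipschitz bounds stand
    in for absolute continuity because they glue directly. *)
Definition traj t tau x0 (u : R -> Vec m) (xi : R -> Vec n) (c : R -> Vec p) :=
  xi t = x0 /\ c t = vzero /\ admissible T U u /\
  lipschitz_on t tau xi Mf /\ lipschitz_on t tau c ML /\
  ae_on t tau (fun s => has_vderiv xi s (f (xi s) (u s))) /\
  ae_on t tau (fun s => has_vderiv c s (L (xi s) (u s))).

(** The step is an Euler step up to second order: within time [h] the state moves by at most
    [Mf * h], so the velocities change by at most [K * Mf * h]. *)
Lemma constant_control x0 v h : U v -> 0 < h -> h * Kf <= / 2 ->
  exists (x : R -> Vec n) (c : R -> Vec p), x 0 = x0 /\ c 0 = vzero /\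
    (forall s, 0 <= s <= h -> has_vderiv x s (f (x s) v)) /\
    (forall s, 0 <= s <= h -> has_vderiv c s (L (x s) v)) /\
    norm (vsub (vsub (x h) x0) (vscal h (f x0 v))) <= K * Mf * h * h /\
    norm (vsub (c h) (vscal h (L x0 v))) <= K * Mf * h * h.
Proof.
  intros Hv Hh HhK.
  assert (HMf : 0 <= Mf) by (eapply Rle_trans; [apply norm_nonneg|apply (hfB x0 v Hv)]).
  destruct (ode_local _ (fun x => f x v) Kf Mf h x0) as (x & X0 & HX & LX); auto; [lra|].
  pose proof (Rabs_pos KL) as HKL.
  destruct (primitive_exists _ (fun s => L (x s) v) (Rabs KL * Mf)) as (c & C0 & HC).
  { intros r s; eapply Rle_trans; [now apply hLL|].
    rewrite Rmult_assoc; apply Rle_trans with (Rabs KL * norm (vsub (x r) (x s))).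
    - apply Rmult_le_compat_r; [apply norm_nonneg|apply Rle_abs].
    - apply Rmult_le_compat_l; [assumption|now apply lipschitz_on_abs]. }
  exists x, c; repeat split; auto.
  - assert (Lp : lipschitz_on 0 h (fun r => vsub (x r) (vscal r (f x0 v))) (K * Mf * h)).
    { apply deriv_lipschitz with (fun r => vsub (f (x r) v) (f x0 v)).
      - intros s Hs; apply has_vderiv_sub; [now apply HX|apply has_vderiv_linear].
      - intros s Hs; eapply Rle_trans; [now apply hfL|].
        specialize (LX 0 s 0 s ltac:(lra) ltac:(lra) ltac:(lra)); rewrite X0 in LX.
        apply Rle_trans with (Kf * (Mf * h)).
        + apply Rmult_le_compat_l; [lra|]; eapply Rle_trans; [exact LX|]; apply Rmult_le_compat_l; lra.
        + unfold K; assert (0 <= Rabs KL * (Mf * h)) by (apply Rmult_le_pos; nra); lra. }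
    specialize (Lp 0 h ltac:(lra) ltac:(lra) ltac:(lra)); cbv beta in Lp; rewrite X0 in Lp.
    replace (vsub (vsub (x h) x0) (vscal h (f x0 v))) with
      (vsub (vsub (x h) (vscal h (f x0 v))) (vsub x0 (vscal 0 (f x0 v)))) by vec_ext.
    eapply Rle_trans; [exact Lp|]; right; ring.
  - assert (Lp : lipschitz_on 0 h (fun r => vsub (c r) (vscal r (L x0 v))) (K * Mf * h)).
    { apply deriv_lipschitz with (fun r => vsub (L (x r) v) (L x0 v)).
      - intros s Hs; apply has_vderiv_sub; [now apply HC|apply has_vderiv_linear].
      - intros s Hs; eapply Rle_trans; [now apply hLL|].
        specialize (LX 0 s 0 s ltac:(lra) ltac:(lra) ltac:(lra)); rewrite X0 in LX.
        apply Rle_trans with (Rabs KL * norm (vsub (x s) x0)).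
        { apply Rmult_le_compat_r; [apply norm_nonneg|apply Rle_abs]. }
        apply Rle_trans with (Rabs KL * (Mf * h)).
        + apply Rmult_le_compat_l; [lra|]; eapply Rle_trans; [exact LX|]; apply Rmult_le_compat_l; lra.
        + unfold K; assert (0 <= Kf * (Mf * h)) by (apply Rmult_le_pos; nra); lra. }
    specialize (Lp 0 h ltac:(lra) ltac:(lra) ltac:(lra)); cbv beta in Lp; rewrite C0 in Lp.
    replace (vsub (c h) (vscal h (L x0 v))) with
      (vsub (vsub (c h) (vscal h (L x0 v))) (vsub vzero (vscal 0 (L x0 v)))) by vec_ext.
    eapply Rle_trans; [exact Lp|]; right; ring.
Qed.

Lemma traj_extend t tau x0 u xi c v h : 0 <= t <= tau -> U v -> 0 < h -> h * Kf <= / 2 ->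
  traj t tau x0 u xi c ->
  exists u' xi' c', traj t (tau + h) x0 u' xi' c' /\ (forall s, s <= tau -> c' s = c s) /\
    norm (vsub (vsub (xi' (tau + h)) (xi tau)) (vscal h (f (xi tau) v))) <= K * Mf * h * h /\
    norm (vsub (vsub (c' (tau + h)) (c tau)) (vscal h (L (xi tau) v))) <= K * Mf * h * h.
Proof.
  intros Ht Hv Hh HhK (Hx & Hc & Hu & Lx & Lc & Dx & Dc).
  destruct (constant_control (xi tau) v h Hv Hh HhK) as (y & d & Y0 & D0 & HY & HD & EY & ED).
  set (y' := fun s => y (s - tau)); set (d' := fun s => vadd (c tau) (d (s - tau))).
  assert (Ey : xi tau = y' tau) by (unfold y'; now rewrite Rminus_diag).
  assert (Ed : c tau = d' tau) by (unfold d'; rewrite Rminus_diag, D0; vec_ext).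
  assert (HY' : forall s, tau <= s <= tau + h -> has_vderiv y' s (f (y' s) v)).
  { intros s Hs; apply (has_vderiv_shift _ y); apply HY; lra. }
  assert (HD' : forall s, tau <= s <= tau + h -> has_vderiv d' s (L (y' s) v)).
  { intros s Hs i; replace (L (y' s) v i) with (0 + L (y' s) v i) by ring.
    apply (derivable_pt_lim_plus (fct_cte (c tau i)) (fun r => d (r - tau) i) s).
    - apply derivable_pt_lim_const.
    - apply (has_vderiv_shift _ d); apply HD; lra. }
  exists (switch tau u (fun _ => v)), (switch tau xi y'), (switch tau c d').
  refine (conj (conj _ (conj _ (conj _ (conj _ (conj _ (conj _ _)))))) _).
  - destruct (Rlt_le_dec t tau); [now rewrite switch_lt|]; rewrite switch_ge by lra.
    replace t with tau in * by lra; congruence.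
  - destruct (Rlt_le_dec t tau); [now rewrite switch_lt|]; rewrite switch_ge by lra.
    replace t with tau in * by lra; congruence.
  - apply admissible_switch; [lra|assumption|assumption].
  - apply lipschitz_switch; [assumption| |assumption].
    apply deriv_lipschitz with (fun s => f (y' s) v); [assumption|auto].
  - apply lipschitz_switch; [assumption| |assumption].
    apply deriv_lipschitz with (fun s => L (y' s) v); [assumption|auto].
  - eapply ae_switch; [exact Dx|intros s Hs; apply HY'; lra| |];
      intros s Hs; simpl; [now rewrite !switch_lt|now rewrite !switch_ge by lra].
  - eapply ae_switch; [exact Dc|intros s Hs; apply HD'; lra| |];
      intros s Hs; simpl; [now rewrite !switch_lt|now rewrite !switch_ge by lra].
  - split.
    { intros s Hs; destruct (Rle_lt_or_eq_dec _ _ Hs) as [D| ->]; [now apply switch_lt|].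
      rewrite switch_ge by lra; now symmetry. }
    rewrite !switch_ge by lra; unfold y', d'; replace (tau + h - tau) with h by ring.
    split; [assumption|].
    replace (vsub (vadd (c tau) (d h)) (c tau)) with (d h) by vec_ext; assumption.
Qed.

Lemma steps_exist len dmax : 0 < len -> 0 < dmax -> exists N, (0 < N)%nat /\ len / INR N <= dmax.
Proof.
  intros Hl Hd; destruct (INR_unbounded (len / dmax)) as [N HN].
  assert (0 < len / dmax) by (now apply Rdiv_lt_0_compat).
  exists N; split; [apply INR_lt; simpl; lra|].
  apply Rmult_le_reg_r with (INR N); [lra|]; replace (len / INR N * INR N) with len by (field; lra).
  apply Rmult_lt_compat_l with (r := dmax) in HN; [|assumption].
  replace (dmax * (len / dmax)) with len in HN by (field; lra); lra.
Qed.

(** Local existence needs [d * Kf <= / 2], so one constant control is repeated on equal short steps.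
    This fills the stretches next to [t] and [T] on which no aiming takes place. *)
Lemma traj_prolong t tau tau' x0 u xi c : 0 <= t <= tau -> tau <= tau' -> (exists v, U v) ->
  traj t tau x0 u xi c -> exists u' xi' c', traj t tau' x0 u' xi' c' /\ c' tau = c tau.
Proof.
  intros Ht Htau [v Hv] Htr; destruct (Rle_lt_or_eq_dec _ _ Htau) as [D| <-]; [|now exists u, xi, c].
  destruct (steps_exist (tau' - tau) (/ (2 * Kf))) as (N & HN & Hd); [lra|apply Rinv_0_lt_compat; lra|].
  apply lt_0_INR in HN; set (d := (tau' - tau) / INR N) in *.
  assert (Hd0 : 0 < d) by (apply Rdiv_lt_0_compat; lra).
  assert (HdK : d * Kf <= / 2).
  { apply Rle_trans with (/ (2 * Kf) * Kf); [apply Rmult_le_compat_r; lra|right; field; lra]. }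
  assert (H : forall i, exists u' xi' c',
    traj t (tau + INR i * d) x0 u' xi' c' /\ c' tau = c tau).
  { intros i; induction i as [|i (u' & xi' & c' & IH & Ec)].
    - exists u, xi, c; simpl; replace (tau + 0 * d) with tau by ring; now split.
    - pose proof (pos_INR i); assert (0 <= INR i * d) by nra.
      destruct (traj_extend t (tau + INR i * d) x0 u' xi' c' v d) as (u2 & xi2 & c2 & H2 & E2 & _);
        try assumption; [lra|].
      exists u2, xi2, c2; split; [|rewrite E2 by lra; assumption]; rewrite S_INR.
      replace (tau + (INR i + 1) * d) with (tau + INR i * d + d) by ring; assumption. }
  destruct (H N) as (u' & xi' & c' & H' & Ec); exists u', xi', c'; split; [|assumption].
  replace (tau + INR N * d) with tau' in H' by (unfold d; field; lra); assumption.
Qed.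

(** [2 * K] comes from the drift, [K * Mf] from the Euler error, which [wdist_step] multiplies by
    the squared distance. *)
Let A := 2 * K + K * Mf.

(* On each step the control is chosen against the normal at the closest point of the graph. *)
Lemma aiming t x0 t0 T' u xi c y xb yb e : 0 <= t <= t0 -> 0 < t0 -> t0 < T' -> T' < T ->
  0 <= Mf -> traj t t0 x0 u xi c -> gr t0 xb yb -> 0 < e ->
  wdist 1 t0 (xi t0) (vsub y (c t0)) t0 xb yb <= e ->
  exists u' xi' c', traj t T' x0 u' xi' c' /\ exists tz xz yz, gr tz xz yz /\
    wdist 1 T' (xi' T') (vsub y (c' T')) tz xz yz <= 2 * e * exp (A * T).
Proof.
  intros Ht Ht0 HtT' HT' HMf Htr Hgb He Heb.
  assert (HK : 0 <= K) by (unfold K; pose proof (Rabs_pos KL); lra).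
  set (C := K * Mf); assert (HC : 0 <= C) by (unfold C; nra).
  assert (HA : 0 <= A) by (unfold A; fold C; lra).
  set (R0 := 2 * e * exp (A * T)).
  assert (Hexpm : forall r s, r <= s -> exp (A * r) <= exp (A * s)).
  { intros r s Hrs; apply exp_monotone; nra. }
  assert (Hexp1 : forall s, 0 <= s -> 1 <= exp (A * s)).
  { intros s Hs; pose proof (exp_ineq1_le (A * s)); nra. }
  assert (HR0 : 0 < R0) by (unfold R0; specialize (Hexp1 T ltac:(lra)); nra).
  set (mu := Rmin t0 (T - T')).
  assert (Hmu : 0 < mu) by (apply Rmin_pos; lra).
  pose proof (Rmin_l t0 (T - T')) as Hmu1; pose proof (Rmin_r t0 (T - T')) as Hmu2; fold mu in Hmu1, Hmu2.
  assert (Hmusq : 0 < mu ^ 2) by (apply pow_lt; assumption).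
  set (l := 1 + R0 / mu ^ 2).
  assert (Hl : 1 <= l).
  { unfold l; assert (0 < R0 / mu ^ 2) by (now apply Rdiv_lt_0_compat); lra. }
  assert (Hlmu : R0 < l * mu ^ 2).
  { unfold l; replace ((1 + R0 / mu ^ 2) * mu ^ 2) with (mu ^ 2 + R0) by (field; lra); lra. }
  set (M := Rabs Mf + Rabs ML).
  assert (HM : 0 <= M) by (unfold M; pose proof (Rabs_pos Mf); pose proof (Rabs_pos ML); lra).
  (* Sum of the coefficients of [d * d] in one step: [2] from the tolerance in the choice of the
     control, [2 * C] from the Euler error, the rest from the quadratic term of [wdist_step]. *)
  set (B := 2 + 2 * C + l + 2 * (M + C) ^ 2).
  assert (HB : 1 <= B) by (unfold B; pose proof (pow2_ge_0 (M + C)); lra).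
  (* The three bounds allow [d * d <= d], local existence of the solution, and a total error
     [B * T * d] of at most [e]. *)
  set (dmax := Rmin (Rmin 1 (/ (2 * Kf))) (e / (B * T))).
  assert (HBT : 0 < B * T) by (apply Rmult_lt_0_compat; lra).
  assert (Hdmax : 0 < dmax).
  { unfold dmax; repeat apply Rmin_pos; [lra|apply Rinv_0_lt_compat; lra|now apply Rdiv_lt_0_compat]. }
  destruct (steps_exist (T' - t0) dmax) as (N & HN & Hd); [lra|assumption|].
  apply lt_0_INR in HN; set (d := (T' - t0) / INR N) in *.
  assert (Hd0 : 0 < d) by (apply Rdiv_lt_0_compat; lra).
  assert (Hd1 : d <= 1 /\ d <= / (2 * Kf) /\ d <= e / (B * T)).
  { pose proof (Rmin_l (Rmin 1 (/ (2 * Kf))) (e / (B * T))).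
    pose proof (Rmin_r (Rmin 1 (/ (2 * Kf))) (e / (B * T))).
    pose proof (Rmin_l 1 (/ (2 * Kf))); pose proof (Rmin_r 1 (/ (2 * Kf))); unfold dmax in Hd; lra. }
  destruct Hd1 as (Hd1 & Hd2 & Hd3).
  assert (HdK : d * Kf <= / 2).
  { apply Rle_trans with (/ (2 * Kf) * Kf); [apply Rmult_le_compat_r; lra|right; field; lra]. }
  assert (HdB : B * T * d <= e).
  { apply Rle_trans with (B * T * (e / (B * T))); [apply Rmult_le_compat_l; lra|right; field; lra]. }
  assert (HNd : INR N * d = T' - t0) by (unfold d; field; lra).
  (* Discrete Gronwall: the exponential carries the growth, the other factor adds the initial error
     and [B * d * d] for each completed step. *)
  assert (H : forall i, (i <= N)%nat -> exists u' xi' c', traj t (t0 + INR i * d) x0 u' xi' c' /\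
    exists tz xz yz, gr tz xz yz /\
      wdist l (t0 + INR i * d) (xi' (t0 + INR i * d)) (vsub y (c' (t0 + INR i * d))) tz xz yz <=
      exp (A * (INR i * d)) * (e + B * (INR i * d) * d)).
  { intros i; induction i as [|i IH]; intros Hi.
    - exists u, xi, c; simpl INR; rewrite !Rmult_0_l, !Rplus_0_r; split; [assumption|].
      exists t0, xb, yb; split; [assumption|].
      rewrite Rmult_0_r, exp_0; unfold wdist in *; nra.
    - destruct (IH ltac:(lia)) as (u1 & xi1 & c1 & H1 & t' & x' & y' & G' & D').
      assert (Hin : INR i * d + d <= T' - t0).
      { rewrite <- HNd; apply le_INR in Hi; rewrite S_INR in Hi; nra. }
      pose proof (pos_INR i) as Hi0; assert (Hid : 0 <= INR i * d) by nra.
      rewrite S_INR; replace ((INR i + 1) * d) with (INR i * d + d) by ring.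
      set (q := INR i * d) in *; set (tau := t0 + q) in *.
      destruct (closest_exists _ _ T (upset W P) l tau (xi1 tau) (vsub y (c1 tau)) t' x' y' h1 Hl G')
        as (tz & xz & yz & Hcl).
      set (Phi := wdist l tau (xi1 tau) (vsub y (c1 tau)) tz xz yz).
      set (Z := e + B * q * d) in *.
      assert (HPhi : Phi <= exp (A * q) * Z) by exact (Rle_trans _ _ _ (proj2 Hcl t' x' y' G') D').
      assert (HPhi0 : 0 <= Phi) by (now apply wdist_nonneg).
      assert (HZ : 0 <= Z <= 2 * e).
      { assert (0 <= B * q * d) by (apply Rmult_le_pos; [apply Rmult_le_pos|]; lra).
        assert (B * q * d <= B * T * d).
        { apply Rmult_le_compat_r; [lra|]; apply Rmult_le_compat_l; lra. }
        unfold Z; lra. }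
      assert (HPR : Phi <= R0).
      { eapply Rle_trans; [exact HPhi|]; unfold R0; rewrite (Rmult_comm (2 * e)).
        apply Rmult_le_compat; [left; apply exp_pos|lra|apply Hexpm; lra|lra]. }
      assert (Htz : 0 < tz < T).
      { apply (closest_time_interior l tau (xi1 tau) (vsub y (c1 tau)) tz xz yz R0 mu);
          try assumption; unfold tau; lra. }
      destruct (closest_velocity _ _ _ _ _ _ _ Hl Htz Hcl) as [_ Hv].
      (* Taking the step length as tolerance makes its contribution [2 * d * d] of second order. *)
      destruct (Hv d Hd0) as (v & Uv & Hvd).
      pose proof (Lipschitz_drift l tau (xi1 tau) (vsub y (c1 tau)) tz xz yz v Hl Uv) as Hdr.
      fold Phi in Hdr; apply Rabs_le_between in Hdr.
      destruct (traj_extend t tau x0 u1 xi1 c1 v d) as (u2 & xi2 & c2 & H2 & _ & E1 & E2);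
        try assumption; [unfold tau; lra|].
      exists u2, xi2, c2; replace (t0 + (q + d)) with (tau + d) by (unfold tau; ring).
      split; [assumption|]; exists tz, xz, yz; split; [apply Hcl|].
      assert (Hf : norm (f (xi1 tau) v) <= M).
      { eapply Rle_trans; [now apply hfB|]; unfold M; pose proof (Rle_abs Mf); pose proof (Rabs_pos ML); lra. }
      assert (HL : norm (vopp (L (xi1 tau) v)) <= M).
      { rewrite norm_opp; eapply Rle_trans; [now apply hLB|]; unfold M.
        pose proof (Rle_abs ML); pose proof (Rabs_pos Mf); lra. }
      assert (HCd : 0 <= C * d) by nra.
      pose proof (wdist_step _ _ l tau (xi1 tau) (vsub y (c1 tau)) tz xz yz d
        (vsub (xi2 (tau + d)) (xi1 tau)) (vsub (c1 tau) (c2 (tau + d)))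
        (f (xi1 tau) v) (vopp (L (xi1 tau) v)) (C * d) M Hl HCd Hf HL) as St.
      rewrite (Rabs_pos_eq d) in St by lra; specialize (St E1).
      assert (E2' : norm (vsub (vsub (c1 tau) (c2 (tau + d))) (vscal d (vopp (L (xi1 tau) v)))) <= C * d * d).
      { rewrite <- norm_opp; eapply Rle_trans; [|exact E2]; right; f_equal; vec_ext. }
      specialize (St E2').
      replace (vadd (xi1 tau) (vsub (xi2 (tau + d)) (xi1 tau))) with (xi2 (tau + d)) in St by vec_ext.
      replace (vadd (vsub y (c1 tau)) (vsub (c1 tau) (c2 (tau + d)))) with (vsub y (c2 (tau + d)))
        in St by vec_ext.
      fold Phi in St; rewrite inner_opp_r in St.
      set (Phi' := wdist l (tau + d) _ _ _ _ _) in *.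
      assert (S1 : Phi' <= Phi * (1 + A * d) + B * d * d).
      { assert (V : 2 * d * (l * (tau - tz) + inner (vsub (xi1 tau) xz) (f (xi1 tau) v)
          + - inner (vsub (vsub y (c1 tau)) yz) (L (xi1 tau) v)) <= 2 * d * (d + K * Phi))
          by (apply Rmult_le_compat_l; lra).
        assert (V2 : d * (C * d) * (2 + Phi) <= 2 * C * d * d + C * d * Phi).
        { assert (0 <= C * d * Phi) by (now apply Rmult_le_pos).
          assert (d * (C * d * Phi) <= 1 * (C * d * Phi)) by (now apply Rmult_le_compat_r); lra. }
        assert (V3 : d ^ 2 * (l + 2 * (M + C * d) ^ 2) <= d ^ 2 * (l + 2 * (M + C) ^ 2)).
        { apply Rmult_le_compat_l; [apply pow2_ge_0|].
          assert (C * d <= C) by (rewrite <- (Rmult_1_r C) at 2; now apply Rmult_le_compat_l).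
          assert ((M + C * d) ^ 2 <= (M + C) ^ 2) by (apply pow_incr; lra); lra. }
        unfold A, B; fold C; lra. }
      rewrite (Rmult_plus_distr_l A q d), exp_plus.
      assert (Ed : 1 + A * d <= exp (A * d)) by apply exp_ineq1_le.
      assert (Eq1 : 1 <= exp (A * q)) by (apply Hexp1; lra).
      assert (Ed1 : 1 <= exp (A * d)) by (apply Hexp1; lra).
      set (Eq := exp (A * q)) in *; set (E := exp (A * d)) in *.
      apply Rle_trans with (Eq * E * (Z + B * d * d)); [|right; unfold Z; ring].
      assert (V1 : Phi * (1 + A * d) <= Eq * Z * E).
      { apply Rmult_le_compat; try assumption; nra. }
      assert (V4 : 0 <= B * d * d) by (apply Rmult_le_pos; nra).
      assert (V5 : 1 <= Eq * E) by nra.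
      assert (V6 : 1 * (B * d * d) <= Eq * E * (B * d * d)) by (now apply Rmult_le_compat_r).
      lra. }
  destruct (H N (le_n N)) as (u' & xi' & c' & H1 & tz & xz & yz & G & D).
  rewrite HNd in *; replace (t0 + (T' - t0)) with T' in * by ring.
  exists u', xi', c'; split; [assumption|]; exists tz, xz, yz; split; [assumption|].
  fold R0; apply Rle_trans with (wdist l T' (xi' T') (vsub y (c' T')) tz xz yz).
  { unfold wdist; pose proof (pow2_ge_0 (T' - tz)); nra. }
  eapply Rle_trans; [exact D|]; unfold R0; rewrite (Rmult_comm (2 * e)).
  assert (B * (T' - t0) * d <= B * T * d).
  { apply Rmult_le_compat_r; [lra|]; apply Rmult_le_compat_l; lra. }
  assert (0 <= B * (T' - t0) * d) by (apply Rmult_le_pos; [apply Rmult_le_pos|]; lra).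
  apply Rmult_le_compat; [left; apply exp_pos|lra|apply Hexpm; lra|lra].
Qed.

(** * From approximate viability to dominated costs *)

Hypothesis (hMf : 0 < Mf).
Hypothesis (hUne : exists v, U v).

Let hML : 0 <= ML.
Proof.
  destruct hUne as [v Hv]; eapply Rle_trans; [apply norm_nonneg|apply (hLB vzero v Hv)].
Qed.

Lemma traj_Yset t x u xi c : traj t T x u xi c -> Yset T U f L t x (c T).
Proof.
  intros (Hx & Hc & Hu & Lx & Lc & Dx & Dc); exists u, xi; split; [assumption|]; split.
  - split; [assumption|]; split; [|assumption]; apply lipschitz_abs_cont with Mf; [lra|assumption].
  - exists c; split; [assumption|]; split; [|now split].
    now apply lipschitz_abs_cont with ML.
Qed.

Lemma traj_point t x : exists u xi c, traj t t x u xi c.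
Proof.
  destruct hUne as [v Hv]; exists (fun _ => v), (fun _ => x), (fun _ => vzero).
  assert (Hae : forall Q : R -> Prop, ae_on t t Q).
  { intros Q; apply null_set_subset with (2 := null_set_point t); intros s [Hs _]; lra. }
  refine (conj eq_refl (conj eq_refl (conj _ (conj _ (conj _ (conj (Hae _) (Hae _))))))).
  - now apply admissible_const.
  - intros r s Hr Hrs Hs; rewrite norm_sub_self; apply Rmult_le_pos; lra.
  - intros r s Hr Hrs Hs; rewrite norm_sub_self; apply Rmult_le_pos; [apply hML|lra].
Qed.

Lemma interior_start t x y e : 0 <= t < T -> gr t x y -> 0 < e ->
  exists t0 x0 y0, t <= t0 /\ t0 - t <= e /\ 0 < t0 < T /\ gr t0 x0 y0 /\
    norm (vsub x x0) <= e /\ norm (vsub y y0) <= e.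
Proof.
  intros Ht G He; destruct (Rle_lt_or_eq_dec 0 t) as [D| <-]; [lra| |].
  - exists t, x, y; rewrite !norm_sub_self; repeat split; try lra; apply G.
  - destruct (proj1 (h3 x y) (proj2 G)) as (tk & xk & yk & Hk & Ck & Cx & Cy).
    rewrite vcv_iff in Cx, Cy; destruct (Cx e He) as [N1 H1]; destruct (Cy e He) as [N2 H2].
    destruct (Ck (Rmin e T)) as [N3 H3]; [apply Rmin_pos; lra|].
    set (k := max N1 (max N2 N3)); destruct (Hk k) as [Htk Gk].
    specialize (H1 k ltac:(lia)); specialize (H2 k ltac:(lia)); specialize (H3 k ltac:(lia)).
    pose proof (Rmin_l e T); pose proof (Rmin_r e T).
    unfold Rdist in H3; rewrite Rminus_0_r, Rabs_pos_eq in H3 by lra.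
    exists (tk k), (xk k), (yk k); rewrite (norm_sub_sym _ x), (norm_sub_sym _ y).
    repeat split; try lra; assumption.
Qed.

(** Three arcs: an arbitrary control up to an interior time, aiming until shortly before [T], and an
    arbitrary control to the end. The outer arcs last at most [e] and contribute terms of order [e];
    [C] is fixed before [e]. For [xz] a bound is enough, as the fibre of the graph at time [T] is
    [P] whatever the state. *)
Lemma approximate_cost t x y : 0 <= t < T -> gr t x y ->
  exists C, 0 <= C /\ forall e, 0 < e <= 1 -> exists J tz xz yz, Yset T U f L t x J /\
    gr tz xz yz /\ Rabs (tz - T) <= C * e /\ norm xz <= C /\
    norm (vsub yz (vsub y J)) <= C * e.
Proof.
  intros Ht G.
  assert (HK : 0 <= K) by (unfold K; pose proof (Rabs_pos KL); lra).
  set (X := exp (A * T)).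
  assert (HX : 1 <= X).
  { unfold X; assert (0 <= A * T); [|pose proof (exp_ineq1_le (A * T)); lra].
    apply Rmult_le_pos; [unfold A|lra]; assert (0 <= K * Mf) by (apply Rmult_le_pos; lra); lra. }
  set (M := Mf + ML); assert (HM : 0 <= M) by (unfold M; pose proof hML; lra).
  assert (HMf : Mf <= M) by (unfold M; pose proof hML; lra).
  assert (HML : ML <= M) by (unfold M; lra).
  (* Square root of the aiming estimate: [4 * ((M + 1) * e) ^ 2 * X <= (D * e) ^ 2] because
     [1 <= X]. *)
  set (D := 2 * (M + 1) * X).
  assert (HD : 0 <= D) by (unfold D; apply Rmult_le_pos; lra).
  pose proof (norm_nonneg _ x) as Hnx.
  assert (HMT : 0 <= M * T) by (apply Rmult_le_pos; lra).
  exists (norm x + M * T + D + M + 1); split; [lra|]; intros e He.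
  set (C := norm x + M * T + D + M + 1).
  destruct (interior_start t x y e Ht G ltac:(lra)) as (t0 & x0 & y0 & H1 & H2 & H3 & G0 & Bx & By).
  destruct (traj_point t x) as (u1 & xi1 & c1 & Tr1).
  destruct (traj_prolong t t t0 x u1 xi1 c1) as (u2 & xi2 & c2 & Tr2 & _); try assumption; [lra|].
  assert (Hw : wdist 1 t0 (xi2 t0) (vsub y (c2 t0)) t0 x0 y0 <= 2 * ((M + 1) * e) ^ 2).
  { destruct Tr2 as (X2 & C2 & _ & Lx & Lc & _).
    specialize (Lx t t0 ltac:(lra) ltac:(lra) ltac:(lra)); rewrite X2 in Lx.
    specialize (Lc t t0 ltac:(lra) ltac:(lra) ltac:(lra)); rewrite C2 in Lc.
    assert (N1 : norm (vsub (xi2 t0) x0) <= (M + 1) * e).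
    { pose proof (norm_sub_triang _ x (xi2 t0) x0).
      assert (Mf * (t0 - t) <= M * e) by (apply Rmult_le_compat; lra); lra. }
    assert (N2 : norm (vsub (vsub y (c2 t0)) y0) <= (M + 1) * e).
    { replace (vsub (vsub y (c2 t0)) y0) with (vadd (vsub y y0) (vopp (vsub (c2 t0) vzero))) by vec_ext.
      eapply Rle_trans; [apply norm_add|]; rewrite norm_opp.
      assert (ML * (t0 - t) <= M * e) by (apply Rmult_le_compat; try apply hML; lra); lra. }
    unfold wdist; rewrite <- !norm_sqr, Rminus_diag.
    pose proof (norm_nonneg _ (vsub (xi2 t0) x0)); pose proof (norm_nonneg _ (vsub (vsub y (c2 t0)) y0)).
    pose proof (Rmult_le_compat _ _ _ _ H H N1 N1); pose proof (Rmult_le_compat _ _ _ _ H0 H0 N2 N2); lra. }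
  set (T' := T - Rmin e ((T - t0) / 2)).
  assert (HT' : t0 < T' /\ T' < T /\ T - T' <= e) by (unfold T', Rmin; destruct Rle_dec; lra).
  destruct (aiming t x t0 T' u2 xi2 c2 y x0 y0 (2 * ((M + 1) * e) ^ 2))
    as (u3 & xi3 & c3 & Tr3 & tz & xz & yz & Gz & Dz); try assumption; try lra.
  { assert (0 < ((M + 1) * e) ^ 2) by (apply pow_lt, Rmult_lt_0_compat; lra); lra. }
  assert (Dz' : wdist 1 T' (xi3 T') (vsub y (c3 T')) tz xz yz <= (D * e) ^ 2).
  { eapply Rle_trans; [exact Dz|]; fold X; unfold D.
    replace (2 * (2 * ((M + 1) * e) ^ 2) * X) with (4 * ((M + 1) * e) ^ 2 * X) by ring.
    replace ((2 * (M + 1) * X * e) ^ 2) with (4 * ((M + 1) * e) ^ 2 * (X * X)) by ring.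
    apply Rmult_le_compat_l; [pose proof (pow2_ge_0 ((M + 1) * e)); lra|nra]. }
  apply wdist_small in Dz'; [|apply Rmult_le_pos; lra]; destruct Dz' as (Zt & Zx & Zy).
  destruct (traj_prolong t T' T x u3 xi3 c3) as (u4 & xi4 & c4 & Tr4 & Ec); try assumption; try lra.
  exists (c4 T), tz, xz, yz; split; [now apply traj_Yset with u4 xi4|]; split; [assumption|].
  assert (De : D * e <= D) by (rewrite <- (Rmult_1_r D) at 2; apply Rmult_le_compat_l; lra).
  assert (Ce : (D + M + 1) * e <= C * e) by (apply Rmult_le_compat_r; unfold C; lra).
  assert (Me : 0 <= M * e) by (apply Rmult_le_pos; lra).
  split; [|split].
  - apply Rabs_le_between in Zt; apply Rabs_le; lra.
  - destruct Tr3 as (X3 & _ & _ & Lx & _).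
    specialize (Lx t T' ltac:(lra) ltac:(lra) ltac:(lra)); rewrite X3 in Lx.
    assert (Mf * (T' - t) <= M * T) by (apply Rmult_le_compat; lra).
    pose proof (norm_le_sub _ xz (xi3 T')); pose proof (norm_le_sub _ (xi3 T') x); unfold C; lra.
  - destruct Tr4 as (_ & _ & _ & _ & Lc & _).
    specialize (Lc T' T ltac:(lra) ltac:(lra) ltac:(lra)); rewrite Ec in Lc.
    assert (ML * (T - T') <= M * e) by (apply Rmult_le_compat; try apply hML; lra).
    replace (vsub yz (vsub y (c4 T))) with
      (vadd (vsub yz (vsub y (c3 T'))) (vsub (c4 T) (c3 T'))) by vec_ext.
    eapply Rle_trans; [apply norm_add|]; assert (0 <= e) by lra; lra.
Qed.

(** The points [yz], close to [y - J], accumulate at some [ys] in the fibre over time [T], which is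
    [P]. Hence the attainable costs accumulate at [y - ys]. *)
Lemma upset_dominates_cost t x y : 0 <= t <= T -> upset W P t x y ->
  exists J, vclosure (Yset T U f L t x) J /\ P (vsub y J).
Proof.
  intros Ht Hy; destruct (Rle_lt_or_eq_dec t T (proj2 Ht)) as [HtT| ->].
  2:{ destruct (traj_point T x) as (u & xi & c & Tr); exists vzero; split.
      - intros e He; exists (c T); split; [now apply traj_Yset with u xi|].
        destruct Tr as (_ & -> & _); rewrite norm_sub_self; assumption.
      - destruct Hy as (w & q & HW & Pq & ->); apply h4 in HW; subst w.
        replace (vsub (vadd vzero q) vzero) with q by vec_ext; assumption. }
  destruct (approximate_cost t x y) as (C & HC & Happ); [lra|now split|].
  assert (Hk : forall k : nat, exists z : Vec p * R * Vec n * Vec p,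
    let '(J, tz, xz, yz) := z in Yset T U f L t x J /\
    gr tz xz yz /\ Rabs (tz - T) <= C * / (INR k + 1) /\ norm xz <= C /\
    norm (vsub yz (vsub y J)) <= C * / (INR k + 1)).
  { intros k; destruct (Happ (/ (INR k + 1))) as (J & tz & xz & yz & H).
    - pose proof (pos_INR k); split; [apply Rinv_0_lt_compat; lra|].
      rewrite <- Rinv_1; apply Rinv_le_contravar; lra.
    - exists (J, tz, xz, yz); exact H. }
  apply functional_choice in Hk; destruct Hk as [z Hz].
  set (J := fun k => fst (fst (fst (z k)))); set (tz := fun k => snd (fst (fst (z k)))).
  set (xz := fun k => snd (fst (z k))); set (yz := fun k => snd (z k)).
  assert (Hz' : forall k, Yset T U f L t x (J k) /\ gr (tz k) (xz k) (yz k) /\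
    Rabs (tz k - T) <= C * / (INR k + 1) /\ norm (xz k) <= C /\
    norm (vsub (yz k) (vsub y (J k))) <= C * / (INR k + 1)).
  { intros k; specialize (Hz k); unfold J, tz, xz, yz; destruct (z k) as [[[j a] b] d]; exact Hz. }
  assert (Hcv : Un_cv (fun k => C * / (INR k + 1)) 0).
  { replace 0 with (C * 0) by ring; apply CV_mult; [|apply Un_cv_inv_INR].
    intros e He; exists O; intros; unfold Rdist; rewrite Rminus_diag, Rabs_R0; assumption. }
  assert (Hinv : forall k, C * / (INR k + 1) <= C).
  { intros k; rewrite <- (Rmult_1_r C) at 2; apply Rmult_le_compat_l; [assumption|].
    rewrite <- Rinv_1; apply Rinv_le_contravar; pose proof (pos_INR k); lra. }
  destruct (graph_subseq _ _ T (upset W P) tz xz yz (norm y + Rabs ML * T + C) h1)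
    as (phi & ts & xs & ys & Hphi & G & Ct & _ & Cy).
  { intros k; apply Hz'. }
  { intros k; destruct (Hz' k) as (_ & _ & _ & H & _); pose proof (norm_nonneg _ y).
    assert (0 <= Rabs ML * T) by (apply Rmult_le_pos; [apply Rabs_pos|lra]); lra. }
  { intros k; destruct (Hz' k) as (HJ & _ & _ & _ & H); apply Yset_bounded in HJ; [|assumption].
    pose proof (norm_le_sub _ (yz k) (vsub y (J k))).
    replace (vsub y (J k)) with (vadd y (vopp (J k))) in H0 at 1 by vec_ext.
    pose proof (norm_add _ y (vopp (J k))) as H'; rewrite norm_opp in H'.
    specialize (Hinv k); lra. }
  assert (Ets : ts = T).
  { apply (UL_sequence (fun k => tz (phi k))); [assumption|].
    intros e He; destruct (Un_cv_subseq _ _ phi Hphi Hcv e He) as [N HN]; exists N; intros k Hk.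
    specialize (HN k Hk); unfold Rdist in *; rewrite Rminus_0_r in HN.
    eapply Rle_lt_trans; [apply (Hz' (phi k))|]; eapply Rle_lt_trans; [apply Rle_abs|exact HN]. }
  subst ts; destruct G as [_ (w & q & HW & Pq & Eys)]; apply h4 in HW; subst w.
  assert (Py : P ys) by (subst ys; replace (vadd vzero q) with q by vec_ext; assumption).
  exists (vsub y ys); split; [|replace (vsub y (vsub y ys)) with ys by vec_ext; assumption].
  intros e He; rewrite vcv_iff in Cy.
  destruct (Cy (e / 2) ltac:(lra)) as [N1 H1].
  destruct (Un_cv_subseq _ _ phi Hphi Hcv (e / 2) ltac:(lra)) as [N2 H2].
  set (k := max N1 N2); specialize (H1 k ltac:(lia)); specialize (H2 k ltac:(lia)).
  unfold Rdist in H2; rewrite Rminus_0_r in H2; pose proof (Rle_abs (C * / (INR (phi k) + 1))) as H3.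
  destruct (Hz' (phi k)) as (HJ & _ & _ & _ & H).
  exists (J (phi k)); split; [assumption|].
  replace (vsub (J (phi k)) (vsub y ys)) with
    (vadd (vsub (yz (phi k)) (vsub y (J (phi k)))) (vopp (vsub (yz (phi k)) ys))) by vec_ext.
  eapply Rle_lt_trans; [apply norm_add|]; rewrite norm_opp; lra.
Qed.

(** * The two inclusions *)

Lemma Vset_subset_upset t x y : 0 <= t <= T -> Vset T U f L P t x y -> upset W P t x y.
Proof.
  intros Ht [Hy _]; apply graph_closed; [assumption|]; intros e He.
  destruct (Hy e He) as (z & Hz & Hd); exists t, x, z.
  split; [split; [assumption|now apply Yset_subset_upset]|].
  rewrite Rminus_diag, Rabs_R0, norm_sub_self; lra.
Qed.

Lemma subset_upset_Vset t x y : vclosed_set P -> pointed P -> 0 <= t <= T -> W t x y ->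
  upset (Vset T U f L P) P t x y.
Proof.
  intros HPc HPp Ht Hy; destruct (upset_dominates_cost t x y Ht) as (J & HJ & PJ).
  { exists y, vzero; repeat split; [assumption|assumption|vec_ext]. }
  destruct (efficient_below _ (vclosure (Yset T U f L t x)) P (Rabs ML * T) J) as (v & Hv & Pv);
    try assumption.
  - apply vclosure_closed.
  - apply vclosure_bounded; intros; now apply Yset_bounded with t x.
  - exists v, (vadd (vsub J v) (vsub y J)); split; [assumption|].
    split; [now apply cone_add|vec_ext].
Qed.

End Viability.

Theorem theorem8p3
  (T : R) (n m p : nat) (U : Vec m -> Prop)
  (f : Vec n -> Vec m -> Vec n) (L : Vec n -> Vec m -> Vec p)
  (Kf Mf KL ML : R) (P : Vec p -> Prop)
  (W : R -> Vec n -> Vec p -> Prop)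
  (* standing assumptions (MOC) *)
  (hT : 0 < T) (hn : (1 <= n)%nat) (hm : (1 <= m)%nat) (hp : (1 <= p)%nat)
  (hUne : exists u, U u) (hUc : vcompact_set U)
  (hKf : 0 < Kf) (hMf : 0 < Mf)
  (hfc : forall x u, U u -> forall eps, 0 < eps -> exists d, 0 < d /\
     forall x' u', U u' -> norm (vsub x' x) < d -> norm (vsub u' u) < d ->
       norm (vsub (f x' u') (f x u)) < eps)
  (hfL : forall x1 x2 u, U u -> norm (vsub (f x1 u) (f x2 u)) <= Kf * norm (vsub x1 x2))
  (hfB : forall x u, U u -> norm (f x u) <= Mf)
  (hLc : forall x u, U u -> forall eps, 0 < eps -> exists d, 0 < d /\
     forall x' u', U u' -> norm (vsub x' x) < d -> norm (vsub u' u) < d ->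
       norm (vsub (L x' u') (L x u)) < eps)
  (hLB : forall x u, U u -> norm (L x u) <= ML)
  (hLL : forall x1 x2 u, U u -> norm (vsub (L x1 u) (L x2 u)) <= KL * norm (vsub x1 x2))
  (hPcl : vclosed_set P) (hPcv : vconvex_set P) (hPcone : is_cone P)
  (hPpt : pointed P) (hP0 : P vzero) (hPint : nonempty_interior P)
  (* (1) *)
  (h1 : osc_on T (upset W P))
  (* (2) *)
  (h2 : forall t x y ws, 0 < t < T -> W t x y ->
     (exists xis vs, coderiv T (upset W P) t x y ws xis vs) ->
     forall xis vs, coderiv T (upset W P) t x y ws xis vs ->
       exists a b, FL U f L x a b /\
         (forall a' b', FL U f L x a' b' ->
            inner vs a + inner ws b <= inner vs a' + inner ws b') /\
         xis + (inner vs a + inner ws b) = 0)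
  (* (3) *)
  (h3 : forall x y,
     (upset W P 0 x y -> limsup_within (fun t => 0 < t <= T) (upset W P) 0 x y) /\
     (upset W P T x y -> limsup_within (fun t => 0 <= t < T) (upset W P) T x y))
  (* (4) *)
  (h4 : forall x y, W T x y <-> y = vzero) :
  forall t x, 0 <= t <= T ->
    (forall y, Vset T U f L P t x y -> upset W P t x y) /\
    (forall y, W t x y -> upset (Vset T U f L P) P t x y).
Proof.
  intros t x Ht; split; intros y Hy.
  - eapply Vset_subset_upset; eassumption.
  - eapply subset_upset_Vset; eassumption.
Qed.
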